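(* For each $0<\alpha<1$ and any interval $\mathfrak{I}\subseteq\mathsf{T}$ we have: (i) for $d=2$, $$\dim\mathscr{E}_{\alpha,2}(\mathfrak{I})\ge\min\{1,\ 2(1-\alpha)\};$$ (ii) for every integer $d\ge 3$, $$\dim\mathscr{E}_{\alpha,d}(\mathfrak{I})\ge\left(1+\frac1d\right)\min\left\{\frac{2}{d+2},\ 1-\alpha\right\}.$$
   Context: Write $\mathbf{e}(x)=\exp(2\pi i x)$. $\mathsf{T}=\mathbb{R}/\mathbb{Z}$ is identified with $[0,1)$; intervals have positive length. For $x\in[0,1)$ and $N\in\mathbb{N}$ let $\sigma_d(x;N)=\sum_{n=1}^{N}\mathbf{e}(xn^d)$, and let $$\mathscr{E}_{\alpha,d}=\{x\in[0,1):\ |\sigma_d(x;N)|\ge N^{\alpha}\text{ for infinitely many }N\in\mathbb{N}\},\qquad \mathscr{E}_{\alpha,d}(\mathfrak{I})=\mathscr{E}_{\alpha,d}\cap\mathfrak{I}.$$ $\dim$ denotes the Hausdorff dimension. *)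

(* Defs.v *)
From HB Require Import structures.
From mathcomp Require Import all_boot all_order all_algebra.
From mathcomp Require Import complex.
From mathcomp Require Import all_classical all_reals all_analysis.

Set Implicit Arguments.
Unset Strict Implicit.
Unset Printing Implicit Defensive.

Import Order.TTheory GRing.Theory Num.Theory.

Local Open Scope classical_set_scope.
Local Open Scope complex_scope.
Local Open Scope ring_scope.

Section hausdorff_dimension.
Context {R : realType}.
Implicit Types (U A : set R) (s delta : R).

(* [set 0] makes the diameter of the empty set 0 rather than -oo. *)
Definition diam U : \bar R :=
  ereal_sup ([set 0%E] `|` [set `|x - y|%:E | x in U & y in U]).

(* diam U ^ s, with 0 ^ 0 = 1 for nonempty U, but always 0 for U = set0, so
   that finite covers may be padded with empty sets also when s = 0. *)
Definition diam_pow s U : \bar R :=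
  if U == set0 then 0%E else (diam U `^ s)%E.

Definition delta_cover delta A (U : nat -> set R) : Prop :=
  A `<=` \bigcup_i U i /\ forall i, (diam (U i) <= delta%:E)%E.

Definition hausdorff_premeasure s delta A : \bar R :=
  ereal_inf [set (\sum_(0 <= i <oo) diam_pow s (U i))%E
            | U in delta_cover delta A].

(* The premeasure is nonincreasing in delta, so this supremum is the limit
   as delta tends to 0. *)
Definition hausdorff_measure s A : \bar R :=
  ereal_sup [set hausdorff_premeasure s delta A | delta in [set delta | 0 < delta]].

Definition hausdorff_dim A : \bar R :=
  ereal_inf [set s%:E | s in [set s | 0 <= s /\ hausdorff_measure s A = 0%E]].

End hausdorff_dimension.

Section weyl_sums.
Context {R : realType}.
Implicit Types (x alpha : R) (I : set R).

(* R / Z is represented by [0, 1): the class of x is its fractional part. *)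
Definition frac_part x : R := x - (Num.floor x)%:~R.

(* An interval of R / Z is the image of an interval of R of positive length; it
   may thus wrap around 0.  All subintervals of [0, 1) of positive length are
   of this form. *)
Definition torus_interval I : Prop :=
  exists J : set R, [/\ is_interval J,
    exists a b, [/\ J a, J b & a < b] & I = frac_part @` J].

(* exp(2 pi i x) *)
Definition unit_char x : R[i] := cos (2 * pi * x) +i* sin (2 * pi * x).

Definition weyl_sum (d : nat) x (N : nat) : R[i] :=
  \sum_(1 <= n < N.+1) unit_char (x * n%:R ^+ d).

Definition large_weyl_sums alpha (d : nat) : set R :=
  [set x : R | 0 <= x < 1 /\
    infinite_set [set N : nat | (0 < N)%N /\
      (N%:R `^ alpha)%:C <= `|weyl_sum d x N| ] ].

End weyl_sums.

(* Main.v *)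
(* Near a rational a/q the sum sigma_d(x; N) is about as large as at a/q: if t <= N
   maximises |sigma_d(a/q; t)|, Abel summation shows that |sigma_d(y; t)| is at
   least half of that maximum whenever |y - a/q| N^d <= 1/(4 pi).  For d = 2 we
   take q = p prime, where the Gauss sum gives |sigma_2| ~ N / sqrt p.  For d >= 3
   we take q = p^d: the multiples of p contribute N / p, and the mean square over
   a mod p^d of the contribution of the other n is O(d N (1 + N / p^d)), because
   n^d = m^d (mod p^d) confines m to d classes, so for most a it is negligible.

   With e = 1 or e = d, there are Q^(e+1-o(1)) such fractions a/p^e with p <= Q;
   two of them with different p differ by k/(p p')^e with k <> 0, and for given p, p'
   each k occurs for at most one pair of numerators, so after discarding few of them they are
   Q^(-e-1-o(1))-separated.  Hence they are spread over every interval regularly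
   enough for any exponent s below the claimed dimension: any k >= 2 of the chosen
   fractions span a length r with k << (number of fractions) (r / length)^s.

   The lower bound for the Hausdorff measure avoids constructing a measure: given
   a cover of small total weight, regularity yields inside any interval of small
   covering weight one of the small intervals around the fractions with the same
   property, and the resulting nested intervals shrink to a point of the set which
   the cover misses. *)

Require Import Defs.
From mathcomp Require Import all_boot all_order all_algebra.
From mathcomp Require Import all_classical all_reals all_analysis.
From mathcomp Require Import complex ring lra zify.

Set Implicit Arguments.
Unset Strict Implicit.
Unset Printing Implicit Defensive.

Import Order.TTheory GRing.Theory Num.Theory numFieldNormedType.Exports.
Import complex.
Local Open Scope classical_set_scope.
Local Open Scope ring_scope.

(** * Hausdorff measure and nested intervals *)

Section descent.
Context {R : realType}.
Implicit Types (s C u v rho : R) (P : seq R).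
Implicit Types (U : nat -> set R) (w : nat -> R).

Definition meets (A : set R) u v : bool := `[< A `&` `[u, v] !=set0 >].

Definition hit_weight U w u v : \bar R :=
  (\sum_(0 <= i <oo) (if meets (U i) u v then w i else 0)%:E)%E.

Lemma meetsP (A : set R) u v :
  reflect (exists2 y, A y & u <= y <= v) (meets A u v).
Proof.
apply: (iffP (asboolP _)) => [[y [Ay]]|[y Ay yuv]].
  by rewrite /= in_itv /= => yuv; exists y.
by exists y; split=> //=; rewrite in_itv.
Qed.

(* A set U i meeting several of the children is charged the common value T to
   each child it meets instead of w i; regularity of P makes this cheaper. *)
Lemma descent_step s C u v rho P U w :
  0 < s -> s <= 1 -> 0 < C -> u < v -> 0 < rho ->
  (forall i, 0 <= w i) ->
  (forall i x y, U i x -> U i y -> `|x - y| `^ s <= w i) ->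
  uniq P ->
  (forall x, x \in P -> u <= x - rho /\ x + rho <= v) ->
  (forall x y, x \in P -> y \in P -> x != y -> 4 * rho <= `|x - y|) ->
  (forall S, uniq S -> {subset S <= P} -> (1 < size S)%N ->
    exists x y, [/\ x \in S, y \in S, x != y &
      (size S)%:R <= C * (size P)%:R * (`|x - y| / (v - u)) `^ s]) ->
  (v - u) `^ s <= (size P)%:R * (2 * rho) `^ s ->
  (hit_weight U w u v < ((2 * C)^-1 * (v - u) `^ s)%:E)%E ->
  exists2 x, x \in P &
    (hit_weight U w (x - rho) (x + rho) < ((2 * C)^-1 * (2 * rho) `^ s)%:E)%E.
Proof.
move=> s0 s1 C0 uv rho0 w0 wU uP Pin sep reg card Slt.
apply: contrapT => nex.
have l0 : 0 < (v - u) `^ s by rewrite powR_gt0 // subr_gt0.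
have m0 : (0 < (size P)%:R :> R).
  rewrite ltr0n lt0n; apply/eqP => m0; move: card.
  by rewrite m0 mul0r leNgt l0.
(* If every child fails, each has hit weight at least [T], since [card] bounds [(v - u)^s / size P]
   by [(2 * rho)^s]. Summed over [P], these shares give back the threshold of the parent. *)
pose T := (2 * C)^-1 * (v - u) `^ s / (size P)%:R.
have T0 : 0 < T by rewrite !mulr_gt0 ?invr_gt0 // mulr_gt0.
have hitC x : x \in P -> (T%:E <= hit_weight U w (x - rho) (x + rho))%E.
  move=> xP; rewrite leNgt; apply/negP => lt; apply: nex; exists x => //.
  apply: lt_le_trans lt _; rewrite lee_fin /T -mulrA ler_wpM2l //.
    by rewrite invr_ge0 mulr_ge0 // ltW.
  by rewrite ler_pdivrMr // mulrC.
pose hitset i := [seq x <- P | meets (U i) (x - rho) (x + rho)].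
pose g i := if (size (hitset i) <= 1)%N then w i else T.
have g0 i : 0 <= g i by rewrite /g; case: ifP => _ //; exact: ltW.
(* Replacing [w] by [g] keeps the share: a set meeting this child and another one alone supplies
   [T], and without such a set the weights at this child are unchanged. *)
have big x : x \in P -> (T%:E <= \sum_(0 <= i <oo)
    (if meets (U i) (x - rho) (x + rho) then g i else 0)%:E)%E.
  move=> xP.
  have t0 i : (0 <= (if meets (U i) (x - rho) (x + rho) then g i else 0)%:E)%E.
    by rewrite lee_fin; case: ifP.
  have [[i [hi si]]|nbig] := pselect (exists i,
      meets (U i) (x - rho) (x + rho) /\ (1 < size (hitset i))%N).
    apply: le_trans (nneseries_lim_ge i.+1 _) => [|k _ _]; last exact: t0.
    rewrite big_nat_recr //= hi /g leqNgt si /=.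
    by apply: lee_paddl => //; apply: sume_ge0 => k _; exact: t0.
  apply: le_trans (hitC _ xP) _; apply: lee_nneseries => [i _ _|i _].
    by rewrite lee_fin; case: ifP.
  rewrite lee_fin; case: ifP => // hi.
  by rewrite /g leqNgt; case: ltnP => // si; case: nbig; exists i.
have key i : g i * (size (hitset i))%:R <= if meets (U i) u v then w i else 0.
  have [h0|hn0] := posnP (size (hitset i)).
    by rewrite h0 mulr0; case: ifP.
  have [x xh] : exists x, x \in hitset i.
    by case: (hitset i) hn0 => // a l _; exists a; rewrite mem_head.
  have -> : meets (U i) u v.
    move: xh; rewrite mem_filter => /andP[/meetsP[y Uy /andP[y1 y2]] xP].
    have [a1 a2] := Pin _ xP.
    by apply/meetsP; exists y => //; apply/andP; split; lra.
  rewrite /g; case: leqP => h1.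
    by have /eqP -> : size (hitset i) == 1%N; rewrite ?eqn_leq ?h1 ?mulr1.
  have [a [b [ah bh ab Hk]]] := reg (hitset i) (filter_uniq _ uP)
    (mem_subseq (filter_subseq _ _)) h1.
  move: ah bh; rewrite !mem_filter => /andP[/meetsP[y Uy /andP[y1 y2]] aP].
  move=> /andP[/meetsP[z Uz /andP[z1 z2]] bP].
  have wyz := wU _ _ _ Uy Uz.
  have sab := sep _ _ aP bP ab.
  (* [y] and [z] are within [rho] of [a] and [b], so [|a - b| <= |y - z| + 2 * rho], and [2 * rho]
     is at most half of [|a - b|]. *)
  have ab2 : `|a - b| <= 2 * `|y - z|.
    move: sab; case: (ger0P (a - b)) => ?; case: (ger0P (y - z)) => ? ?; lra.
  (* The loss [2^s <= 2] is what the factor 2 in the threshold [(2 * C)^-1] pays for. *)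
  have Hw : `|a - b| `^ s <= 2 * w i.
    apply: (@le_trans _ _ ((2 * `|y - z|) `^ s)).
      apply: ge0_ler_powR; rewrite ?nnegrE ?mulr_ge0 //; exact: ltW.
    rewrite powRM //; apply: ler_pM => //; try exact: powR_ge0.
    by rewrite -[leRHS]powRr1 //; apply: ler_powR => //; lra.
  have abE : (`|a - b| / (v - u)) `^ s = `|a - b| `^ s / (v - u) `^ s.
    rewrite powRM ?invr_ge0 ?subr_ge0 ?(ltW uv) //.
    congr (_ * _); rewrite -powR_inv1 ?subr_ge0 ?ltW //.
    by rewrite -powRrM mulN1r powRN.
  have Hk2 : (size (hitset i))%:R <= C * (size P)%:R * (2 * w i / (v - u) `^ s).
    apply: le_trans Hk _; rewrite abE; apply: ler_wpM2l.
      by rewrite mulr_ge0 // ltW.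
    by rewrite ler_wpM2r // invr_ge0 ltW.
  apply: le_trans (ler_wpM2l (ltW T0) Hk2) _.
  by rewrite /T le_eqVlt; apply/orP; left; apply/eqP; field; rewrite !gt_eqF.
suff : (((2 * C)^-1 * (v - u) `^ s)%:E <= hit_weight U w u v)%E.
  by rewrite leNgt Slt.
have -> : (2 * C)^-1 * (v - u) `^ s = \sum_(x <- P) T.
  rewrite big_const_seq count_predT iter_addr addr0 -[RHS]mulr_natr /T.
  by field; rewrite !gt_eqF.
rewrite -sumEFin.
apply: (@le_trans _ _ (\sum_(x <- P) \sum_(0 <= i <oo)
    (if meets (U i) (x - rho) (x + rho) then g i else 0)%:E)%E).
  by rewrite !big_seq; apply: lee_sum => x xP; exact: big.
rewrite -nneseries_sum; last by move=> *; rewrite lee_fin; case: ifP.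
apply: lee_nneseries => [i _ _|i _].
  by apply: sume_ge0 => x _; rewrite lee_fin; case: ifP.
rewrite sumEFin lee_fin; apply: le_trans (key i).
rewrite -big_mkcond /= -big_filter big_const_seq count_predT iter_addr addr0.
by rewrite mulr_natr.
Qed.

Lemma hit_weight_ge U w u v i : (forall j, 0 <= w j) -> meets (U i) u v ->
  ((w i)%:E <= hit_weight U w u v)%E.
Proof.
move=> w0 hi; apply: le_trans (nneseries_lim_ge i.+1 _) => [|k _ _].
  rewrite big_nat_recr //= hi; apply: lee_paddl => //.
  by apply: sume_ge0 => k _; rewrite lee_fin; case: ifP.
by rewrite lee_fin; case: ifP.
Qed.

(** Dependent choice produces the chain of intervals, and the supremum of the left endpoints lies in
    all of them. The index in [G] lets the [n]-th step meet the [n]-th requirement. *)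
Lemma nested_intervals (inv : R -> R -> Prop) (G : nat -> R -> R -> Prop)
    u0 v0 :
  (forall u v, inv u v -> u <= v) ->
  (forall n u v, inv u v ->
    exists u' v', [/\ inv u' v', u <= u', v' <= v & G n u' v']) ->
  inv u0 v0 ->
  exists2 x, u0 <= x <= v0 &
    forall n, exists u v, [/\ inv u v, u <= x <= v & G n u v].
Proof.
move=> inv_le step i0.
have [f [f0 fS]] : exists f : nat -> R * R, f 0%N = (u0, v0) /\
    forall n, inv (f n).1 (f n).2 /\ [/\ (f n).1 <= (f n.+1).1,
      (f n.+1).2 <= (f n).2, inv (f n.+1).1 (f n.+1).2 &
      G n (f n.+1).1 (f n.+1).2].
  have step' (x : nat * (R * R)) : exists y : nat * (R * R), y.1 = x.1.+1 /\
      (inv x.2.1 x.2.2 -> [/\ x.2.1 <= y.2.1, y.2.2 <= x.2.2,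
        inv y.2.1 y.2.2 & G x.1 y.2.1 y.2.2]).
    have [ix|nx] := pselect (inv x.2.1 x.2.2).
      have [u' [v' [? ? ? ?]]] := step x.1 _ _ ix.
      by exists (x.1.+1, (u', v')).
    (* Default outside the invariant; the iteration from [(u0, v0)] never reaches it. *)
    by exists (x.1.+1, (0, 0)).
  have [F HF] := choice step'.
  pose h n := iter n F (0%N, (u0, v0)).
  have h1 n : (h n).1 = n by elim: n => //= n IH; rewrite (HF _).1 -/(h n) IH.
  have hinv n : inv (h n).2.1 (h n).2.2.
    by elim: n => //= n IH; have [_ /(_ IH)[]] := HF (h n).
  exists (fun n => (h n).2); split=> // n; split=> //.
  by have [_ /(_ (hinv n))] := HF (h n); rewrite h1.
have mono1 : {homo (fun n => (f n).1) : m n / (m <= n)%N >-> m <= n}.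
  by apply: homo_leq => // [y x z|n]; [exact: le_trans|have [_ []] := fS n].
have mono2 : {homo (fun n => (f n).2) : m n / (m <= n)%N >-> n <= m}.
  apply: homo_leq => // [y x z|n]; first by move=> h1 h2; exact: le_trans h2 h1.
  by have [_ []] := fS n.
have cross m n : (f m).1 <= (f n).2.
  have [mn|nm] := leqP m n.
    apply: le_trans (mono1 _ _ mn) _.
    by have [/inv_le] := fS n.
  apply: le_trans (mono2 _ _ (ltnW nm)).
  by have [/inv_le] := fS m.
pose A := range (fun n => (f n).1).
have supA : has_sup A.
  split; first by exists (f 0%N).1, 0%N.
  by exists (f 0%N).2 => _ [m _ <-].
have xin n : (f n).1 <= sup A <= (f n).2.
  apply/andP; split; first by apply: ub_le_sup => //; [case: supA|exists n].
  by apply: ge_sup => [|_ [m _ <-]]; [case: supA|exact: cross].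
exists (sup A); first by have := xin 0%N; rewrite f0.
move=> n; exists (f n.+1).1, (f n.+1).2; split => //.
  by have [] := fS n.+1.
by have [_ []] := fS n.
Qed.

(** The fourth clause is a discrete Frostman condition: a cluster of points cannot have a span too
    short for its size. The last one says that the children together have at least the [s]-content
    of the parent. *)
Definition regular_points s C u v rho P :=
  [/\ uniq P,
   (forall x, x \in P -> u <= x - rho /\ x + rho <= v),
   (forall x y, x \in P -> y \in P -> x != y -> 4 * rho <= `|x - y|),
   (forall S, uniq S -> {subset S <= P} -> (1 < size S)%N ->
    exists x y, [/\ x \in S, y \in S, x != y &
      (size S)%:R <= C * (size P)%:R * (`|x - y| / (v - u)) `^ s])
   & (v - u) `^ s <= (size P)%:R * (2 * rho) `^ s].

(* C is uniform in the interval: a loss at each level of the descent would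
   accumulate. *)
Definition regular_family s C u0 v0 (W : nat -> set R) :=
  forall u v n, u0 <= u -> u < v -> v <= v0 ->
  exists rho P, [/\ 0 < rho, 2 * rho <= n.+1%:R^-1, regular_points s C u v rho P
    & forall x y, x \in P -> `|y - x| <= rho -> W n y].

(** A mass distribution principle without a measure. Below the threshold, the descent yields a point
    of [E] in intervals whose hit weights tend to 0, whereas a set [U i] containing this point
    contributes [w i > 0] to each of them. *)
Lemma cover_weight_ge s C u0 v0 (W : nat -> set R) (E : set R) U w :
  0 < s -> s <= 1 -> 0 < C -> u0 < v0 -> regular_family s C u0 v0 W ->
  (forall x, u0 <= x <= v0 -> (forall n, W n x) -> E x) ->
  E `<=` \bigcup_i U i -> (forall i, 0 < w i) ->
  (forall i x y, U i x -> U i y -> `|x - y| `^ s <= w i) ->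
  (((2 * C)^-1 * (v0 - u0) `^ s)%:E <= \sum_(0 <= i <oo) (w i)%:E)%E.
Proof.
move=> s0 s1 C0 uv0 fam WE cov w0 wU; rewrite leNgt; apply/negP => lt.
have w0' i : 0 <= w i by exact: ltW.
pose inv u v := [/\ u0 <= u, u < v, v <= v0 &
  (hit_weight U w u v < ((2 * C)^-1 * (v - u) `^ s)%:E)%E].
pose G n u v := v - u <= n.+1%:R^-1 /\ forall y, u <= y <= v -> W n y.
have [] := @nested_intervals inv G u0 v0.
- by move=> u v [_ /ltW].
- move=> n u v [u0u uv vv0 hw].
  have [rho [P [rho0 rhon [uP Pin sep reg card] PW]]] := fam u v n u0u uv vv0.
  have [x xP hx] := descent_step s0 s1 C0 uv rho0 w0' wU uP Pin sep reg card hw.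
  have [x1 x2] := Pin _ xP.
  have E2 : x + rho - (x - rho) = 2 * rho by ring.
  exists (x - rho), (x + rho); split => //.
    split; rewrite ?E2 //; lra.
  split; first by rewrite E2.
  move=> y /andP[y1 y2]; apply: (PW x) => //.
  by rewrite ler_norml; apply/andP; split; lra.
- split=> //; apply: le_lt_trans lt; apply: lee_nneseries => [i _ _|i _].
    by rewrite lee_fin; case: ifP.
  by rewrite lee_fin; case: ifP.
move=> x xuv xG.
have Ex : E x.
  by apply: WE => // n; have [u [v [_ xu [_]]]] := xG n; exact.
have [i _ Ux] := cov _ Ex.
(* [U i] contains [x], hence meets the interval of every stage and is counted in its hit weight. *)
have wlt n : w i < (2 * C)^-1 * n.+1%:R^-1 `^ s.
  have [u [v [[_ uv _ hw] xu [vun _]]]] := xG n.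
  rewrite -lte_fin; apply: le_lt_trans (hit_weight_ge w0' _) _.
    by apply/meetsP; exists x; [exact: Ux|exact: xu].
  apply: lt_le_trans hw _; rewrite lee_fin ler_wpM2l //.
    by rewrite invr_ge0 mulr_ge0 // ltW.
  by apply: ge0_ler_powR => //; rewrite ?nnegrE ?subr_ge0 ?ltW.
have a0 : 0 < (2 * C * w i) `^ s^-1 by rewrite powR_gt0 // !mulr_gt0.
have [n ] := @ltr_add_invr R 0 _ a0; rewrite add0r => hn.
have := wlt n; rewrite ltNge => /negP; apply.
rewrite ler_pdivrMl ?mulr_gt0 //.
have -> : 2 * C * w i = ((2 * C * w i) `^ s^-1) `^ s.
  by rewrite -powRrM mulVf ?gt_eqF // powRr1 // !mulr_ge0 // ltW.
by apply: ge0_ler_powR; rewrite ?nnegrE ?powR_ge0 ?ltW.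
Qed.

Lemma le_diam (A : set R) x y : A x -> A y -> (`|x - y|%:E <= diam A)%E.
Proof.
by move=> Ax Ay; apply: ereal_sup_ubound; right; exists x => //; exists y.
Qed.

Lemma diam_ge0 (A : set R) : (0 <= diam A)%E.
Proof. by apply: ereal_sup_ubound; left. Qed.

(** The scale [delta = 1] suffices: the premeasure there is a lower bound for the measure, and
    distances at most 1 satisfy [|x - y|^s <= |x - y|^t]. *)
Lemma regular_family_hausdorff_measure s t C u0 v0 (W : nat -> set R)
    (E : set R) :
  0 <= t -> t < s -> s <= 1 -> 0 < C -> u0 < v0 -> regular_family s C u0 v0 W ->
  (forall x, u0 <= x <= v0 -> (forall n, W n x) -> E x) ->
  hausdorff_measure t E <> 0%E.
Proof.
move=> t0 ts s1 C0 uv0 fam WE.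
have s0 : 0 < s by exact: le_lt_trans ts.
pose c := (2 * C)^-1 * (v0 - u0) `^ s.
have c0 : 0 < c by rewrite mulr_gt0 ?invr_gt0 ?mulr_gt0 // powR_gt0 // subr_gt0.
suff H : (c%:E <= hausdorff_measure t E)%E.
  by move=> E0; move: H; rewrite E0 lee_fin leNgt c0.
apply: le_trans (ereal_sup_ubound _); last by exists 1 => //=; exact: ltr01.
apply: le_ereal_inf_tmp => _ [U [cov dU] <-].
have dfin i : diam (U i) \is a fin_num.
  rewrite ge0_fin_numE ?diam_ge0 //.
  by apply: le_lt_trans (dU i) _; rewrite ltry.
have pfin i : diam_pow t (U i) \is a fin_num.
  rewrite /diam_pow; case: ifP => // _.
  by rewrite -(fineK (dfin i)).
have p0 i : (0 <= diam_pow t (U i))%E.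
  by rewrite /diam_pow; case: ifP => // _; exact: poweR_ge0.
apply/lee_addgt0Pr => e e0.
(* The geometric padding makes the weights positive also for sets of weight 0, at total cost [e]. *)
pose w i := fine (diam_pow t (U i)) + e / (2 ^ i.+1)%:R.
have w0 i : 0 < w i.
  rewrite ltr_wpDl ?fine_ge0 // divr_gt0 // ltr0n expn_gt0 //.
apply: (@le_trans _ _ (\sum_(0 <= i <oo) (w i)%:E)%E); last first.
  apply: le_trans (epsilon_trick _ _ (ltW e0)) => //.
  apply: lee_nneseries => [i _ _|i _]; first by rewrite lee_fin ltW.
  by rewrite /w EFinD fineK.
apply: (@cover_weight_ge s C u0 v0 W E U w) => // i x y Ux Uy.
have xy1 : `|x - y| <= 1.
  by rewrite -lee_fin; apply: le_trans (le_diam Ux Uy) (dU i).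
apply: (@le_trans _ _ (fine (diam_pow t (U i)))); last first.
  by rewrite lerDl ltW // divr_gt0 // ltr0n expn_gt0.
rewrite -lee_fin fineK // /diam_pow; case: ifP => [/eqP U0|_].
  by move: Ux; rewrite U0.
apply: (@le_trans _ _ (`|x - y| `^ t)%:E).
  rewrite lee_fin; have [->|xy] := eqVneq (`|x - y|) 0.
    by rewrite powR0 ?gt_eqF // powR_ge0.
  by apply: ger_powR; rewrite ?lt_def ?xy ?normr_ge0 //= ltW.
rewrite -poweR_EFin; apply: gt0_ler_poweR => //.
- by rewrite in_itv /= leey andbT.
- by rewrite in_itv /= leey andbT diam_ge0.
- exact: le_diam.
Qed.

Lemma hausdorff_dim_ge (E : set R) D :
  (forall t, 0 <= t -> t < D -> hausdorff_measure t E <> 0%E) ->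
  (D%:E <= hausdorff_dim E)%E.
Proof.
move=> H; apply: le_ereal_inf_tmp => _ [t [t0 tE] <-].
by rewrite lee_fin leNgt; apply/negP => tD; exact: (H t).
Qed.

End descent.

(** * Weyl sums at nearby points *)

Section characters.
Context {R : realType}.
Implicit Types (x y : R) (z : R[i]).
Local Notation e := (@unit_char R).
Local Notation nm := (@Normc.normc R).

Lemma sumr_ler_normc (I : Type) (r : seq I) (P : pred I) (F : I -> R[i]) :
  nm (\sum_(i <- r | P i) F i) <= \sum_(i <- r | P i) nm (F i).
Proof.
elim/big_ind2 : _ => // [|a b c d ab cd]; first by rewrite Normc.normc0.
by apply: le_trans (le_normcD _ _) _; rewrite lerD.
Qed.

Lemma normc_ge0 z : 0 <= nm z.
Proof. by case: z => a b; exact: sqrtr_ge0. Qed.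

Lemma normc_subl z1 z2 : nm z1 - nm z2 <= nm (z1 - z2).
Proof. by rewrite lerBlDr -{1}[z1](subrK z2); exact: le_normcD. Qed.

Lemma normc_sqrE z : ((nm z ^+ 2)%:C)%C = z * (z^*)%C.
Proof.
case: z => a b /=; rewrite sqr_sqrtr ?addr_ge0 ?sqr_ge0 //.
by apply/eqP; rewrite eq_complex /=; apply/andP; split; apply/eqP; ring.
Qed.

Lemma normc_nat n : nm (n%:R : R[i]) = n%:R.
Proof. by rewrite normcMn Normc.normc1. Qed.

Lemma unit_charD x y : e (x + y) = e x * e y.
Proof.
apply/eqP; rewrite eq_complex /= !mulrDr cosD sinD eqxx /=; apply/eqP; ring.
Qed.

Lemma unit_char0 : e 0 = 1.
Proof. by rewrite /unit_char mulr0 cos0 sin0. Qed.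

Lemma conj_unit_char x : (e x)^*%C = e (- x).
Proof. by rewrite /unit_char mulrN cosN sinN. Qed.

Lemma normc_unit_char x : nm (e x) = 1.
Proof. by rewrite /= cos2Dsin2 sqrtr1. Qed.

Lemma unit_char_nat (n : nat) : e n%:R = 1.
Proof.
elim: n => [|n IH]; first exact: unit_char0.
rewrite -natr1 unit_charD IH mul1r /unit_char mulr1 mulrC mulr_natr.
by rewrite cos2pi sin2pi.
Qed.

Lemma unit_char_int (k : int) : e k%:~R = 1.
Proof.
case: k => n; first by rewrite -pmulrn unit_char_nat.
rewrite NegzE mulrNz -pmulrn -conj_unit_char unit_char_nat.
by apply/eqP; rewrite eq_complex /= oppr0 !eqxx.
Qed.

Lemma unit_charX x n : e (x *+ n) = e x ^+ n.
Proof.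
by elim: n => [|n IH]; rewrite ?mulr0n ?unit_char0 // mulrS exprS unit_charD IH.
Qed.

Lemma ler_abs_sin x : `|sin x| <= `|x|.
Proof.
wlog x0 : x / 0 <= x.
  move=> H; case: (leP 0 x) => [/H//|x0].
  by have := H (- x); rewrite sinN !normrN; apply; rewrite oppr_ge0 ltW.
have [|c _] := @MVT_segment _ sin cos _ _ x0 (fun c _ => is_derive_sin c).
  exact/continuous_subspaceT/continuous_sin.
rewrite sin0 !subr0 => ->; rewrite normrM ler_piMl //; exact: cos_max.
Qed.

(** The chord from 1 to [e x] has length [2 |sin (pi x)|]. *)
Lemma normc_unit_char_subr1_le x : nm (e x - 1) <= 2 * pi * `|x|.
Proof.
have -> : nm (e x - 1) = `|2 * sin (pi * x)|.
  rewrite /= oppr0 addr0 -sqrtr_sqr; congr Num.sqrt.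
  have -> : 2 * pi * x = (pi * x) *+ 2 by rewrite mulr2n; ring.
  rewrite cos_mulr2n sin_mulr2n.
  have := cos2Dsin2 (pi * x); set c := cos _; set s := sin _ => H.
  have E : c ^+ 2 = 1 - s ^+ 2 by rewrite -H; ring.
  have -> : (c * s *+ 2) ^+ 2 = 4 * c ^+ 2 * s ^+ 2 by rewrite mulr2n; ring.
  by rewrite E mulr2n; ring.
rewrite normrM ger0_norm // -mulrA ler_wpM2l //.
by apply: le_trans (ler_abs_sin _) _; rewrite normrM ger0_norm // pi_ge0.
Qed.

Lemma unit_char_neq1 x : 0 < x < 1 -> e x != 1.
Proof.
move=> /andP[x0 x1]; apply/negP => /eqP /(congr1 (@Re R)) /= H.
have : 0 < sin (pi * x).
  by apply: sin_gt0_pi; rewrite mulr_gt0 ?pi_gt0 //= gtr_pMr ?pi_gt0.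
move: H; have -> : 2 * pi * x = (pi * x) *+ 2 by rewrite mulr2n; ring.
rewrite cos_mulr2n; have := cos2Dsin2 (pi * x).
by move: (cos _) (sin _) => c s ? ? ?; nra.
Qed.

(** Orthogonality of additive characters: a geometric sum whose ratio is a [q]-th root of unity,
    different from 1 unless [q] divides [k]. *)
Lemma sum_unit_char (q : nat) (k : int) : (0 < q)%N ->
  \sum_(0 <= a < q) e (a%:R * (k%:~R / q%:R)) = if (q %| k)%Z then q%:R else 0.
Proof.
move=> q0; have qn0 : (q%:R != 0 :> R) by rewrite pnatr_eq0 -lt0n.
have eX a : e (a%:R * (k%:~R / q%:R)) = e (k%:~R / q%:R) ^+ a.
  by rewrite mulr_natl unit_charX.
under eq_bigr do rewrite eX.
case: ifPn => [/dvdzP[j ->]|nqk].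
  have -> : (j * q)%:~R / q%:R = j%:~R :> R.
    by rewrite intrM mulrK // unitfE.
  rewrite unit_char_int; under eq_bigr do rewrite expr1n.
  by rewrite sumr_const_nat subn0.
have z1 : e (k%:~R / q%:R) != 1.
  have kE := divz_eq k q.
  have r0 : 0 <= (k %% q)%Z by apply: modz_ge0; rewrite -lt0n.
  have rq : (k %% q)%Z < q by apply: ltz_pmod.
  have rn : (k %% q)%Z != 0 by apply: contra nqk => /eqP k0; apply/dvdz_mod0P.
  have -> : k%:~R / q%:R = (k %/ q)%Z%:~R + (k %% q)%Z%:~R / q%:R :> R.
    by rewrite {1}kE intrD intrM mulrDl -pmulrn mulfK.
  rewrite unit_charD unit_char_int mul1r unit_char_neq1 //.
  apply/andP; split; first by rewrite divr_gt0 ?ltr0n // ltr0z lt_def rn.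
  by rewrite ltr_pdivrMr ?ltr0n // mul1r pmulrn ltr_int.
have zq : e (k%:~R / q%:R) ^+ q = 1.
  by rewrite -unit_charX -[_ *+ q]mulr_natr divfK // unit_char_int.
apply/eqP; rewrite big_mkord; have := subrX1 (e (k%:~R / q%:R)) q.
by rewrite zq subrr => /esym/eqP; rewrite mulf_eq0 subr_eq0 (negPf z1).
Qed.

Lemma weyl_sumS d x N :
  weyl_sum d x N.+1 = weyl_sum d x N + e (x * N.+1%:R ^+ d).
Proof. by rewrite /weyl_sum big_nat_recr. Qed.

Lemma weyl_sum0 d x : weyl_sum d x 0 = 0.
Proof. by rewrite /weyl_sum big_geq. Qed.

Lemma normc_weyl_sum_le d x N : nm (weyl_sum d x N) <= N%:R.
Proof.
apply: le_trans (sumr_ler_normc _ _ _) _.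
under eq_bigr do rewrite normc_unit_char.
by rewrite sumr_const_nat subn1.
Qed.

(* Abel summation against the partial sums at x. *)
Lemma weyl_sum_perturb d x y t B :
  (forall n, (n <= t)%N -> nm (weyl_sum d x n) <= B) ->
  nm (weyl_sum d y t - weyl_sum d x t * e ((y - x) * t%:R ^+ d)) <=
    B * (2 * pi * `|y - x|) * t%:R ^+ d.
Proof.
elim: t => [HB|t IH HB].
  rewrite !weyl_sum0 mul0r subr0 Normc.normc0 !mulr_ge0 ?pi_ge0 ?exprn_ge0 //.
  by apply: le_trans (HB 0%N (leqnn _)); exact: normc_ge0.
set b := y - x.
(* The new term at [y] is the one at [x] times the new twist, so only the change of twist on the
   partial sum at [x] adds to the error. Its bounds telescope in [t^d]. *)
have -> : weyl_sum d y t.+1 - weyl_sum d x t.+1 * e (b * t.+1%:R ^+ d) =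
    (weyl_sum d y t - weyl_sum d x t * e (b * t%:R ^+ d)) +
    weyl_sum d x t * e (b * t%:R ^+ d) *
      (1 - e (b * (t.+1%:R ^+ d - t%:R ^+ d))).
  rewrite !weyl_sumS.
  have -> : y * t.+1%:R ^+ d = x * t.+1%:R ^+ d + b * t.+1%:R ^+ d.
    by rewrite /b; ring.
  have -> : e (b * t.+1%:R ^+ d) =
      e (b * t%:R ^+ d) * e (b * (t.+1%:R ^+ d - t%:R ^+ d)).
    by rewrite -unit_charD; congr (e _); ring.
  have -> : e (x * t.+1%:R ^+ d + b * t.+1%:R ^+ d) = e (x * t.+1%:R ^+ d) *
      (e (b * t%:R ^+ d) * e (b * (t.+1%:R ^+ d - t%:R ^+ d))).
    by rewrite -!unit_charD; congr (e _); ring.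
  ring.
apply: le_trans (le_normcD _ _) _.
have IH' := IH (fun n nt => HB n (leqW nt)).
have step : nm (weyl_sum d x t * e (b * t%:R ^+ d) *
    (1 - e (b * (t.+1%:R ^+ d - t%:R ^+ d)))) <=
    B * (2 * pi * `|b|) * (t.+1%:R ^+ d - t%:R ^+ d).
  rewrite !Normc.normcM normc_unit_char mulr1 -mulrA.
  apply: ler_pM; rewrite ?normc_ge0 //; first exact: HB.
  rewrite -normcN opprB; apply: le_trans (normc_unit_char_subr1_le _) _.
  have td : t%:R ^+ d <= t.+1%:R ^+ d :> R.
    by rewrite lerXn2r ?nnegrE ?ler_nat.
  rewrite normrM (ger0_norm (_ : 0 <= t.+1%:R ^+ d - t%:R ^+ d)) ?subr_ge0 //.
  by rewrite mulrA.
apply: le_trans (lerD IH' step) _.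
by rewrite le_eqVlt; apply/orP; left; apply/eqP; rewrite -/b; ring.
Qed.

(* The largest partial sum at x up to N dominates its own Abel error at y. *)
Lemma weyl_sum_stable d x y M N A : (M <= N)%N ->
  `|y - x| * N%:R ^+ d <= (4 * pi)^-1 -> 2 * A <= nm (weyl_sum d x M) ->
  exists2 t, (t <= N)%N & A <= nm (weyl_sum d y t).
Proof.
move=> MN yx HA.
pose F (i : 'I_N.+1) := nm (weyl_sum d x i).
have [i _ imax] := arg_maxP F (erefl : predT (Ordinal (MN : (M < N.+1)%N))).
have iN : (i <= N)%N by rewrite -ltnS.
exists i => //.
have HB n : (n <= i)%N -> nm (weyl_sum d x n) <= F i.
  move=> ni; have nN : (n < N.+1)%N by rewrite ltnS (leq_trans ni).
  exact: (imax (Ordinal nN)).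
have := weyl_sum_perturb y HB; set E := nm (_ - _) => HE.
have F0 : 0 <= F i by exact: normc_ge0.
have Hd : `|y - x| * i%:R ^+ d <= (4 * pi)^-1.
  apply: le_trans yx; rewrite ler_wpM2l // lerXn2r ?nnegrE //.
  by rewrite ler_nat.
(* The constant [4 * pi] is chosen to make the Abel error at most half of the maximum. *)
have E2 : E <= F i / 2.
  apply: le_trans HE _.
  have -> : F i * (2 * pi * `|y - x|) * i%:R ^+ d =
    F i * (2 * pi) * (`|y - x| * i%:R ^+ d) by ring.
  have -> : F i / 2 = F i * (2 * pi) * (4 * pi)^-1.
    have : (pi : R) != 0 by rewrite gt_eqF ?pi_gt0.
    by move: (pi : R) => p p0; field.
  by rewrite ler_wpM2l // !mulr_ge0 // pi_ge0.
have FM : 2 * A <= F i.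
  by apply: le_trans HA _; exact: (imax (Ordinal (MN : (M < N.+1)%N))).
have : F i - nm (weyl_sum d y i) <= E.
  rewrite /E -[leRHS]normcN opprB; apply: le_trans (normc_subl _ _).
  by rewrite Normc.normcM normc_unit_char mulr1.
lra.
Qed.

End characters.

(** * Power residues modulo prime powers *)

Lemma sum_periodic_shift (V : zmodType) (q n : nat) (f : nat -> V) :
  (forall m, f (m + q)%N = f m) ->
  \sum_(0 <= m < q) f (n + m)%N = \sum_(0 <= m < q) f m.
Proof.
move=> fq; elim: n => [|n <-]; first by apply: eq_bigr.
case: q fq => [|q] fq; first by rewrite !big_geq.
rewrite big_nat_recr // big_nat_recl //= addn0 addrC; congr (_ + _).
  by rewrite addSnnS.
by apply: eq_bigr => i _; rewrite addSnnS.
Qed.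

Lemma leq_double_divn p N : (0 < p)%N -> (p <= N)%N ->
  (N <= 2 * (N %/ p) * p)%N.
Proof.
move=> p0 pN; have Np : (0 < N %/ p)%N by rewrite divn_gt0.
apply: ltnW; apply: leq_trans (ltn_ceil N p0) _.
by rewrite mulSn -mulnA mul2n -addnn leq_add2r leq_pmull.
Qed.

(** Uniqueness in Hensel's lemma: [m^d - m'^d] is [m - m'] times a sum congruent to [d * m^(d-1)]
    modulo [p], which is a unit. *)
Lemma expn_congr_lift p d k m m' : prime p -> ~~ (p %| d)%N -> ~~ (p %| m)%N ->
  m = m' %[mod p] -> m ^ d = m' ^ d %[mod p ^ k] -> m = m' %[mod p ^ k].
Proof.
move=> pp pd.
wlog mm : m m' / (m' <= m)%N.
  move=> H; have [/H//|/ltnW mm] := leqP m' m.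
  move=> pm E1 E2; apply/esym; apply: H => //.
  by move: pm; rewrite /dvdn E1.
move=> pm /eqP E1 /eqP E2; apply/eqP; move: E2.
have d0 : (0 < d)%N by case: (d) pd; rewrite ?dvdn0.
rewrite (eqn_mod_dvd _ mm) eqn_mod_dvd ?leq_exp2r //.
rewrite subn_exp Gauss_dvdl // coprimeXl // prime_coprime //.
have chp := pchar_Fp pp.
have mE : (m%:R : 'F_p) = m'%:R.
  apply/eqP; rewrite -subr_eq0 -natrB // -(dvdn_pcharf chp).
  by rewrite -eqn_mod_dvd // E1.
rewrite (dvdn_pcharf chp) natr_sum.
under eq_bigr => i _.
  rewrite natrM !natrX -mE -exprD subnK; last by have := ltn_ord i; lia.
  over.
rewrite sumr_const card_ord -[_ *+ d]mulr_natr mulf_eq0 expf_eq0.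
by rewrite -!(dvdn_pcharf chp) (negPf pm) (negPf pd) andbF.
Qed.

Lemma Fp_nat_eq p m n : prime p ->
  (m%:R == n%:R :> 'F_p) = (m == n %[mod p])%N.
Proof.
move=> pp; have chp := pchar_Fp pp.
wlog mn : m n / (n <= m)%N.
  move=> H; have [/H//|/ltnW/H] := leqP n m.
  by rewrite eq_sym => ->; rewrite eq_sym.
by rewrite -subr_eq0 -natrB // -(dvdn_pcharf chp) eqn_mod_dvd.
Qed.

(** A solution is determined by its residue modulo [p], one of at most [d] roots of [X^d - c^d] in
    ['F_p], and by its block of length [p^k]: the first fixes it modulo [p^k] by
    [expn_congr_lift]. *)
Lemma count_power_residues p d k c N :
  prime p -> ~~ (p %| d)%N -> ~~ (p %| c)%N -> (0 < k)%N ->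
  (count [pred m | ~~ (p %| m) & m ^ d == c ^ d %[mod p ^ k]]%N (iota 1 N) <=
    d * (N %/ p ^ k).+1)%N.
Proof.
move=> pp pd pc k0; set q := (p ^ k)%N; set good := [pred m | _].
have d0 : (0 < d)%N by case: (d) pd; rewrite ?dvdn0.
have q0 : (0 < q)%N by rewrite expn_gt0 prime_gt0.
have chp := pchar_Fp pp.
pose rts := enum [pred x : 'F_p | root ('X^d - (c%:R ^+ d)%:P) x].
pose f m : 'F_p * nat := (m%:R, (m %/ q)%N).
rewrite -size_filter; set s := [seq m <- _ | good m].
have sE m : m \in s ->
    [/\ ~~ (p %| m)%N, (m ^ d = c ^ d %[mod q])%N & (m <= N)%N].
  by rewrite mem_filter mem_iota => /andP[/andP[? /eqP ?]] /andP[_ ?].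
have finj : {in s &, injective f}.
  move=> m m' /sE[pm mE mN] /sE[pm' mE' mN'] [] E1 E3.
  have E2 : (m = m' %[mod p])%N.
    by apply/eqP; rewrite -Fp_nat_eq // E1.
  have E4 : (m = m' %[mod q])%N.
    by apply: (expn_congr_lift pp pd pm E2); rewrite mE mE'.
  by rewrite (divn_eq m q) (divn_eq m' q) E3 E4.
have us : uniq (map f s) by rewrite map_inj_in_uniq // filter_uniq ?iota_uniq.
rewrite -(size_map f).
apply: leq_trans (uniq_leq_size us (_ : {subset _ <=
    [seq (x, y) | x <- rts, y <- iota 0 (N %/ q).+1]})) _.
  move=> _ /mapP[m /sE[pm mE mN] ->]; apply: allpairs_f.
    rewrite mem_enum inE /root !hornerE subr_eq0 -!natrX.
    rewrite Fp_nat_eq //; apply/eqP.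
    rewrite -(modn_dvdm (m ^ d) (dvdn_exp k0 (dvdnn p))) mE.
    by rewrite modn_dvdm ?dvdn_exp.
  by rewrite mem_iota /= add0n ltnS leq_div2r.
rewrite size_allpairs size_iota leq_mul2r; apply/orP; right.
have cn0 : 'X^d - (c%:R ^+ d)%:P != 0 :> {poly 'F_p}.
  by rewrite -size_poly_eq0 size_XnsubC.
have := max_poly_roots cn0 (_ : all _ rts) (enum_uniq _).
rewrite size_XnsubC // ltnS; apply.
by apply/allP => x; rewrite mem_enum inE.
Qed.

(** * Weyl sums at rational points *)

Section complete_sums.
Context {R : realType}.
Local Notation e := (@unit_char R).
Local Notation nm := (@Normc.normc R).

Lemma unit_char_eq (x y : R) (k : nat) : x - y = k%:R -> e x = e y.
Proof.
by move=> H; rewrite -(subrK y x) H unit_charD unit_char_nat mul1r.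
Qed.

Lemma intr_nat (n : nat) : n%:Z%:~R = n%:R :> R.
Proof. by []. Qed.

(** In [g] times its conjugate, put the difference [h] of the two variables in place of one of them.
    The phase becomes linear in [n], and summing over [n] leaves only [h = 0], because [2 * a] is
    invertible modulo [p]. *)
Lemma normc_gauss_sum (p a : nat) : prime p -> odd p -> ~~ (p %| a)%N ->
  nm (\sum_(0 <= n < p) e (a%:R / p%:R * n%:R ^+ 2)) = Num.sqrt p%:R.
Proof.
move=> pp op pa; set g := \sum_(_ <= _ < _) _.
have p0 : (0 < p)%N by exact: prime_gt0.
have pn0 : (p%:R != 0 :> R) by rewrite pnatr_eq0 -lt0n.
suff H : nm g ^+ 2 = p%:R by rewrite -H sqrtr_sqr ger0_norm // normc_ge0.
apply: complexI; rewrite normc_sqrE rmorph_nat.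
have -> : (g^*)%C = \sum_(0 <= n < p) e (- (a%:R / p%:R * n%:R ^+ 2)).
  by rewrite rmorph_sum; apply: eq_bigr => n _; exact: conj_unit_char.
rewrite mulr_sumr.
have -> : \sum_(0 <= n < p) g * e (- (a%:R / p%:R * n%:R ^+ 2)) =
    \sum_(0 <= n < p) \sum_(0 <= h < p) e (a%:R / p%:R * h%:R ^+ 2) *
       e (n%:R * ((2 * a * h)%N%:Z%:~R / p%:R)).
  apply: eq_bigr => n _; rewrite mulr_suml.
  rewrite -(@sum_periodic_shift _ p n); last first.
    move=> m; congr (_ * _); apply: (@unit_char_eq _ _ (a * (2 * m + p))%N).
    by rewrite !(natrM, natrD); field.
  apply: eq_bigr => h _; rewrite -!unit_charD; congr (e _).
  by rewrite intr_nat !(natrM, natrD); field.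
rewrite exchange_big /=.
under eq_bigr do rewrite -mulr_sumr sum_unit_char //.
have E h : (0 <= h < p)%N -> (p %| (2 * a * h)%N%:Z)%Z = (h == 0%N).
  move=> /andP[_ hp]; rewrite dvdzE !absz_nat !Euclid_dvdM // (negPf pa) orbF.
  have -> : (p %| 2)%N = false.
    apply/negP => /(dvdn_leq (ltn0Sn 1)) p2.
    by move: pp op; case: (p) p2 => [|[|[|]]].
  by case: h hp => [|h] hp; rewrite ?dvdn0 // gtnNdvd.
rewrite big_nat (eq_bigr (fun h => if h == 0%N then p%:R else 0)); last first.
  move=> h hp; rewrite E //; case: eqP => [->|_]; last by rewrite mulr0.
  by rewrite expr0n mulr0 unit_char0 mul1r.
rewrite -big_nat big_ltn // eqxx big_nat big1 ?addr0 // => i /andP[i0 _].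
by rewrite gtn_eqF.
Qed.

Lemma weyl_sum_gauss (p a m : nat) : prime p -> odd p -> ~~ (p %| a)%N ->
  nm (weyl_sum 2 (a%:R / p%:R) (p * m)) = m%:R * Num.sqrt p%:R.
Proof.
move=> pp op pa; have p0 : (0 < p)%N by exact: prime_gt0.
have pn0 : (p%:R != 0 :> R) by rewrite pnatr_eq0 -lt0n.
rewrite -(normc_gauss_sum pp op pa); set g := \sum_(_ <= _ < _) _.
suff -> : weyl_sum 2 (a%:R / p%:R) (p * m) = m%:R * g.
  by rewrite Normc.normcM normc_nat.
pose f n := e (a%:R / p%:R * n%:R ^+ 2).
have fp n : f (n + p)%N = f n.
  apply: (@unit_char_eq _ _ (a * (2 * n + p))%N).
  by rewrite !(natrM, natrD); field.
elim: m => [|m IH]; first by rewrite muln0 weyl_sum0 mul0r.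
rewrite -natr1 mulrDl mul1r -IH /weyl_sum.
rewrite (@big_cat_nat _ _ _ (p * m).+1) //=; last first.
  by rewrite mulnS; lia.
congr (_ + _).
have -> : g = \sum_(0 <= i < p) f i by [].
rewrite -(sum_periodic_shift (p * m).+1 fp) -{1}[(p * m).+1]add0n big_addn.
have -> : ((p * m.+1).+1 - (p * m).+1)%N = p by rewrite mulnS; lia.
by apply: eq_bigr => i _; rewrite addnC.
Qed.

Definition coprime_weyl_sum (p d : nat) (x : R) (N : nat) : R[i] :=
  \sum_(1 <= n < N.+1 | ~~ (p %| n)%N) e (x * n%:R ^+ d).

(** A multiple [k * p] of [p] contributes exactly 1, its phase [a * k^d] being an integer. *)
Lemma weyl_sum_prime_powerE p d a N : prime p ->
  weyl_sum d (a%:R / (p ^ d)%N%:R) N =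
    (N %/ p)%:R + coprime_weyl_sum p d (a%:R / (p ^ d)%N%:R) N.
Proof.
move=> pp; have p0 : (0 < p)%N by exact: prime_gt0.
have qn0 : ((p ^ d)%N%:R != 0 :> R) by rewrite pnatr_eq0 -lt0n expn_gt0 p0.
rewrite /weyl_sum (bigID (fun n => p %| n)%N) /=; congr (_ + _).
rewrite divn_count_dvd natr_sum [RHS](bigID (fun n => p %| n)%N) /=.
rewrite [X in _ + X]big1 ?addr0 => [|i /negPf -> //].
apply: eq_bigr => n pn; rewrite pn; have /dvdnP[k ->] := pn.
rewrite -(unit_char_nat (a * k ^ d)); congr (e _).
by rewrite !natrM exprMn !natrX; field; rewrite -natrX.
Qed.

(** By orthogonality in [a], the sum is [p^d] times the number [K] of pairs with congruent [d]-th
    powers; [count_power_residues] bounds the partners of each of the at most [N] values of [n]. *)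
Lemma mean_square_coprime_weyl_sum p d N : prime p -> ~~ (p %| d)%N ->
  \sum_(0 <= a < p ^ d)
      nm (coprime_weyl_sum p d (a%:R / (p ^ d)%N%:R) N) ^+ 2 <=
    ((p ^ d) * (N * (d * (N %/ p ^ d).+1)))%N%:R.
Proof.
move=> pp pd; set q := (p ^ d)%N.
have d0 : (0 < d)%N by case: (d) pd; rewrite ?dvdn0.
have p0 : (0 < p)%N by exact: prime_gt0.
have q0 : (0 < q)%N by rewrite expn_gt0 p0.
have qn0 : (q%:R != 0 :> R) by rewrite pnatr_eq0 -lt0n.
pose r m n := ((m ^ d == n ^ d %[mod q])%N : nat).
pose K := (\sum_(1 <= n < N.+1 | ~~ (p %| n))
  \sum_(1 <= m < N.+1 | ~~ (p %| m)) r m n)%N.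
have -> : \sum_(0 <= a < q) nm (coprime_weyl_sum p d (a%:R / q%:R) N) ^+ 2 =
    (q * K)%N%:R.
  apply: complexI; rewrite rmorph_sum rmorph_nat /=.
  under eq_bigr do
    rewrite normc_sqrE {2}/coprime_weyl_sum rmorph_sum mulr_sumr /=.
  rewrite exchange_big /= natrM natr_sum mulr_sumr; apply: eq_bigr => n pn.
  under eq_bigr do rewrite mulr_suml.
  rewrite exchange_big /= natr_sum mulr_sumr; apply: eq_bigr => m pm.
  rewrite (eq_bigr (fun a : nat =>
    e (a%:R * (((m ^ d)%N%:Z - (n ^ d)%N%:Z)%:~R / q%:R)))).
    rewrite sum_unit_char // /r -eqz_mod_dvd !modz_nat eqz_nat.
    by case: eqP; rewrite ?mulr1 ?mulr0.
  move=> a _; rewrite -[X in _ * X = _]/((e (a%:R / q%:R * n%:R ^+ d))^*)%C.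
  rewrite conj_unit_char -unit_charD; congr (e _).
  rewrite intrB !intr_nat !natrX; move: (m%:R ^+ d) (n%:R ^+ d) => u v.
  by ring.
rewrite ler_nat leq_mul2l; apply/orP; right.
apply: (@leq_trans (\sum_(1 <= n < N.+1 | ~~ (p %| n)) d * (N %/ q).+1)%N).
  apply: leq_sum => n pn; apply: leq_trans (count_power_residues N pp pd pn d0).
  rewrite -sum1_count /index_iota subn1 /= big_mkcond [leqRHS]big_mkcond /=.
  by apply: leq_sum => m _; rewrite /r; case: (p %| m)%N => //=; case: eqP.
apply: (@leq_trans (\sum_(1 <= n < N.+1) d * (N %/ q).+1)%N).
  by rewrite big_mkcond leq_sum // => i _; case: ifP.
by rewrite sum_nat_const_nat subn1.
Qed.

End complete_sums.

(** * Separated fractions with prime power denominators *)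

Section points.
Context {R : realType}.
Implicit Types (u v delta A B : R) (F : seq nat).

Lemma sorted_gap_size delta (y : R) (t : seq R) :
  path (fun a b => a + delta <= b) y t ->
  (size t)%:R * delta <= last y t - y.
Proof.
elim: t y => [|a t IH] y /=; first by rewrite mul0r subrr.
move=> /andP[ya /IH H]; rewrite -natr1 mulrDl mul1r; lra.
Qed.

(** The witnesses are the least and the greatest element of [S]; consecutive elements of the sorted
    list are [delta] apart. *)
Lemma separated_size delta (S : seq R) : 0 < delta -> uniq S ->
  (forall x y, x \in S -> y \in S -> x != y -> delta <= `|x - y|) ->
  (0 < size S)%N ->
  exists x y, [/\ x \in S, y \in S, x <= y,
    forall z, z \in S -> x <= z <= y & (size S)%:R - 1 <= (y - x) / delta].
Proof.
move=> d0 uS sep S0; set t := sort <=%R S.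
have tS : t =i S by exact: mem_sort.
have st : sorted <=%R t by apply: sort_sorted; exact: le_total.
have szt : size t = size S by rewrite size_sort.
have ut : uniq t by rewrite sort_uniq.
clearbody t; case: t tS st szt ut => [|x t] tS st szt ut.
  by rewrite -szt in S0.
have tr : transitive (<=%R : rel R) by move=> a b c; exact: le_trans.
have xmin z : z \in S -> x <= z.
  rewrite -tS inE => /predU1P[->//|]; move: st => /=.
  by rewrite path_sortedE // => /andP[/allP H _] /H.
have lmax z : z \in S -> z <= last x t.
  move: st; rewrite /= -tS; elim: (t) x {xmin tS szt ut} z => [|a r IH] b z /=.
    by rewrite inE => _ /eqP ->.
  move=> /andP[ba ar]; rewrite inE => /predU1P[->|]; last exact: IH.
  by apply: le_trans ba _; apply: IH; rewrite ?mem_head.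
have xS : x \in S by rewrite -tS mem_head.
have lS : last x t \in S by rewrite -tS mem_last.
exists x, (last x t); split => //.
- exact: lmax.
- by move=> z zS; rewrite xmin // lmax.
rewrite ler_pdivlMr // -szt /= -natr1 addrK.
apply: sorted_gap_size.
have pS : {subset x :: t <= S} by move=> z; rewrite tS.
move: st ut pS => /=; elim: (t) x {xmin lmax tS szt xS lS} => // a r IH b /=.
move=> /andP[ba ar] /andP[]; rewrite inE negb_or => /andP[bna _] ur pS.
apply/andP; split; last by apply: IH => // z zr; apply: pS; rewrite inE zr orbT.
have := sep b a (pS _ (mem_head _ _)) (pS _ _) bna.
rewrite !inE eqxx orbT => /(_ isT); rewrite distrC ger0_norm ?subr_ge0 //; lra.
Qed.

Lemma window_count (q : nat) A B : (0 < q)%N -> 0 <= A -> A <= B -> B < 1 ->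
  q%:R * (B - A) - 1 <=
    (count [pred a : nat | A <= a%:R / q%:R <= B] (iota 0 q))%:R.
Proof.
set win := [pred a : nat | _] => q0 A0 AB B1.
have qp : 0 < q%:R :> R by rewrite ltr0n.
set m := Num.truncn (q%:R * A); set M := Num.truncn (q%:R * B).
have qA0 : 0 <= q%:R * A by rewrite mulr_ge0 // ltW.
have qB0 : 0 <= q%:R * B by rewrite mulr_ge0 ?(ltW qp) // (le_trans A0).
have /andP[m1 m2] := truncn_itv qA0.
have /andP[M1 M2] := truncn_itv qB0.
have H : (M - m <= count win (iota 0 q))%N.
  rewrite -size_filter -(size_iota m.+1 (M - m)); apply: uniq_leq_size.
    exact: iota_uniq.
  move=> a; rewrite mem_iota => /andP[ma aM].
  have aM' : (a <= M)%N by clear -ma aM; lia.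
  have aB : a%:R <= q%:R * B by apply: le_trans M1; rewrite ler_nat.
  rewrite mem_filter mem_iota /= add0n; apply/andP; split; last first.
    rewrite -(ltr_nat R); apply: le_lt_trans aB _.
    by rewrite gtr_pMr.
  rewrite ler_pdivlMr // ler_pdivrMr // ![_ * q%:R]mulrC aB andbT.
  by apply: ltW; apply: lt_le_trans m2 _; rewrite ler_nat.
apply: (@le_trans _ _ (M - m)%N%:R); last by rewrite ler_nat.
have : M%:R <= (M - m)%N%:R + m%:R :> R by rewrite -natrD ler_nat; clear; lia.
move: M2 m1; rewrite -/M -/m -natr1; lra.
Qed.

(** Unreduced fractions, kept as pairs of [p] and a numerator over [p^e]. The value 0 therefore
    occurs once for each [p], which is why numerator 0 is treated apart below. *)
Definition fractions (e : nat) F : seq (nat * nat) :=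
  flatten [seq [seq (p, a) | a <- iota 0 (p ^ e)] | p <- F].

Definition fraction (e : nat) (c : nat * nat) : R := c.2%:R / (c.1 ^ e)%N%:R.

Definition has_close e F delta : pred (nat * nat) := [pred c | has [pred c' |
  (c' != c) && (`|fraction e c - fraction e c'| < delta)] (fractions e F)].

Lemma fraction_separated e p a a' : (0 < p)%N -> a != a' ->
  ((p ^ e)%N%:R)^-1 <= `|fraction e (p, a) - fraction e (p, a')| :> R.
Proof.
move=> p0 aa'; have q0 : 0 < (p ^ e)%N%:R :> R by rewrite ltr0n expn_gt0 p0.
rewrite /fraction /= -mulrBl normrM [X in _ * X]gtr0_norm ?invr_gt0 //.
rewrite ler_peMl ?invr_ge0 ?(ltW q0) //.
have -> : a%:R - a'%:R = (a%:Z - a'%:Z)%:~R :> R by rewrite intrB.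
rewrite -intr_norm -[1]/(1%:~R) ler_int -gtz0_ge1 normr_gt0 subr_eq0.
by rewrite eqz_nat.
Qed.

Lemma mem_fractions e F c :
  (c \in fractions e F) = (c.1 \in F) && (c.2 < c.1 ^ e)%N.
Proof.
apply/flatten_mapP/andP => [[p pF /mapP[a ap ->]]|[cF ce]].
  by rewrite mem_iota in ap.
exists c.1 => //; apply/mapP; exists c.2; first by rewrite mem_iota.
by case: (c).
Qed.

Lemma fractions_uniq e F : uniq F -> uniq (fractions e F).
Proof.
move=> uF; apply: allpairs_uniq_dep => // [p _|c c' _ _].
  exact: iota_uniq.
by case: c c' => [a b] [a' b'] /= [-> ->].
Qed.

Lemma count_fractions (e : nat) F (P : pred (nat * nat)) :
  count P (fractions e F) =
    (\sum_(p <- F) count (fun a => P (p, a)) (iota 0 (p ^ e)))%N.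
Proof.
rewrite /fractions count_flatten -map_comp sumnE big_map; apply: eq_bigr => p _.
by rewrite /= count_map.
Qed.

(* Coprimality of the denominators: a p'^e - b p^e determines a < p^e. *)
Lemma close_fractions_count e Q F delta : (0 < e)%N -> uniq F ->
  (forall p, p \in F -> prime p /\ (p <= Q)%N) ->
  0 <= delta -> delta * Q%:R ^+ e <= 1 ->
  (count [pred c | (0 < c.2)%N & has_close e F delta c] (fractions e F))%:R
  <= 2 * delta * Q%:R ^+ (2 * e + 2) :> R.
Proof.
move=> e0 uF FQ d0 dQ; rewrite -size_filter; set s := [seq c <- _ | _].
(* For close fractions [a / p^e] and [b / p'^e], the integer [k = a * p'^e - b * p^e] has absolute
   value less than [delta * Q^(2 * e)], hence at most [K]. *)
pose K := Num.truncn (delta * Q%:R ^+ (2 * e)).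
have K0 : 0 <= delta * Q%:R ^+ (2 * e) by rewrite mulr_ge0 // exprn_ge0.
have /andP[K1 K2] := truncn_itv K0.
pose ints := [seq i%:Z | i <- iota 1 K] ++ [seq - i%:Z | i <- iota 1 K].
have intsP (k : int) : k != 0 -> (`|k|%N <= K)%N -> k \in ints.
  move=> k0 kK; rewrite mem_cat; apply/orP.
  case: k k0 kK => n k0 kK; [left|right]; apply/mapP.
    by exists n => //; rewrite mem_iota; clear -k0 kK; move: k0 kK => /=; lia.
  by exists n.+1 => //; rewrite mem_iota; clear -kK; move: kK => /=; lia.
have cop p p' : p \in F -> p' \in F -> p' != p -> coprime (p ^ e) (p' ^ e).
  move=> /FQ[pp _] /FQ[pp' _] pn; rewrite coprimeXl // coprimeXr //.
  by rewrite prime_coprime // dvdn_prime2 // eq_sym.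
have H (c : nat * nat) : exists t : nat * int, c \in s ->
    [/\ (c.1 \in F) && (c.2 < c.1 ^ e)%N, t.1 \in F, t.1 != c.1,
      t.2 \in ints &
      exists b : nat, t.2 = c.2%:Z * (t.1 ^ e)%N%:Z - b%:Z * (c.1 ^ e)%N%:Z].
  have [cs|] := boolP (c \in s); last by move=> _; exists (0%N, 0).
  move: (cs); rewrite mem_filter mem_fractions => /andP[/andP[c20 /hasP[c']]].
  rewrite mem_fractions => /andP[c'F c'e] /andP[c'c dlt] /andP[cF ce].
  case: c c' => [p a] [p' b] /= in cs c20 c'F c'e c'c dlt cF ce *.
  have [pp pQ] := FQ _ cF; have [pp' pQ'] := FQ _ c'F.
  have q0 : 0 < (p ^ e)%N%:R :> R by rewrite ltr0n expn_gt0 prime_gt0.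
  have q0' : 0 < (p' ^ e)%N%:R :> R by rewrite ltr0n expn_gt0 prime_gt0.
  have qQ : (p ^ e)%N%:R <= Q%:R ^+ e :> R.
    by rewrite natrX lerXn2r ?nnegrE // ler_nat.
  have qQ' : (p' ^ e)%N%:R <= Q%:R ^+ e :> R.
    by rewrite natrX lerXn2r ?nnegrE // ler_nat.
  pose k : int := a%:Z * (p' ^ e)%N%:Z - b%:Z * (p ^ e)%N%:Z.
  have kE : k%:~R = (fraction e (p, a) - fraction e (p', b)) *
      ((p ^ e)%N%:R * (p' ^ e)%N%:R) :> R.
    rewrite /fraction /= /k intrB !intrM !intr_nat.
    by field; rewrite (gt_eqF q0) (gt_eqF q0').
  (* Two distinct fractions over the same [p^e] are at least [p^(-e) >= delta] apart. *)
  have pp'n : p' != p.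
    apply: contraTneq dlt => E; subst p'; rewrite -leNgt.
    have ab : a != b by apply: contra_neq c'c => ->.
    apply: le_trans (fraction_separated e (prime_gt0 pp) ab).
    by rewrite -div1r ler_pdivlMr //; apply: le_trans dQ; exact: ler_wpM2l.
  exists (p', k) => _; split => //=; [by rewrite cF ce| |by exists b].
  apply: intsP.
    (* If [k = 0], coprimality makes [p^e] divide [a], against [0 < a < p^e]. *)
    apply/negP => /eqP k0.
    have E : (a * p' ^ e = b * p ^ e)%N.
      by move/eqP: k0; rewrite /k subr_eq0 -!PoszM eqz_nat => /eqP.
    have : (p ^ e %| a)%N.
      by rewrite -(@Gauss_dvdl _ _ (p' ^ e)) ?E ?dvdn_mull // cop.
    by move=> /(dvdn_leq c20); rewrite leqNgt ce.
  rewrite -ltnS -(ltr_nat R); apply: le_lt_trans K2.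
  have -> : `|k|%N%:R = `|k%:~R| :> R by rewrite -intr_norm -abszE intr_nat.
  rewrite kE normrM [X in _ * X]ger0_norm ?mulr_ge0 // ?(ltW q0) ?(ltW q0') //.
  rewrite mul2n -addnn exprD; apply: ler_pM; rewrite ?normr_ge0 ?(ltW dlt) //.
  by apply: ler_pM => //; exact: ltW.
have [f fP] := choice H.
have finj : {in s &, injective (fun c => (c.1, f c))}.
  move=> [p a] [p' a'] cs cs' /= [E1 E2]; subst p'.
  have [] := fP _ cs; have [] := fP _ cs'; rewrite -E2 /=.
  case: (f (p, a)) => [p' k] /= {cs cs'} /andP[_ ae'] _ _ _ [b' E'].
  move=> /andP[pF ae] pF' pn _ [b E].
  congr (_, _).
  have copz : coprimez (p ^ e)%N%:Z (p' ^ e)%N%:Z.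
    by rewrite /coprimez /gcdz !absz_nat eqz_nat; exact: cop.
  have : ((p ^ e)%N%:Z %| (a%:Z - a'%:Z) * (p' ^ e)%N%:Z)%Z.
    apply/dvdzP; exists (b%:Z - b'%:Z).
    apply/eqP; rewrite -subr_eq0 !mulrBl.
    have -> : forall x y z t : int, x - y - (z - t) = x - z - (y - t).
      by move=> *; ring.
    by rewrite -E -E' subrr.
  rewrite Gauss_dvdzl // -eqz_mod_dvd !modz_nat eqz_nat !modn_small //.
  by move/eqP.
have : (size s <= size F * (size F * size ints))%N.
  rewrite -(size_map (fun c => (c.1, f c))).
  have us : uniq s by rewrite filter_uniq // fractions_uniq.
  apply: leq_trans (uniq_leq_size _ (_ : {subset _ <=
    [seq (x, y) | x <- F, y <- [seq (x, y) | x <- F, y <- ints]]})) _.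
  - by rewrite map_inj_in_uniq.
  - move=> _ /mapP[c cs ->]; have [/andP[c1 _] f1 _ f2 _] := fP _ cs.
    by rewrite allpairs_f //; case: (f c) f1 f2 => *; rewrite allpairs_f.
  - by rewrite !size_allpairs.
have sF : (size F <= Q)%N.
  rewrite -(size_iota 1 Q); apply: uniq_leq_size => // p /FQ[pp pQ].
  by rewrite mem_iota prime_gt0 //= add1n ltnS.
rewrite size_cat !size_map size_iota => sle.
have : (size s <= Q * (Q * (K + K)))%N.
  by apply: leq_trans sle _; rewrite leq_mul // leq_mul.
rewrite -(ler_nat R) => /le_trans; apply; rewrite !natrM natrD.
have -> : 2 * delta * Q%:R ^+ (2 * e + 2) =
    Q%:R * (Q%:R * (delta * Q%:R ^+ (2 * e) + delta * Q%:R ^+ (2 * e))).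
  by rewrite exprD; ring.
by rewrite !ler_wpM2l // lerD.
Qed.

(** The middle half of [[u, v]] contains at least [(v - u) / 2 * T - Q] of the fractions, where [T]
    is the sum of the [p^e]. By the last hypothesis, this deficit and the bad or close fractions use
    up at most half of the main term. The margins leave room for the small intervals around the
    points. *)
Lemma point_set e Q F (bad : nat -> nat -> bool) u v delta B : (0 < e)%N ->
  uniq F -> (forall p, p \in F -> prime p /\ (p <= Q)%N) ->
  0 <= u -> u < v -> v <= 1 -> 0 < delta -> delta * Q%:R ^+ e <= 1 ->
  (\sum_(p <- F) count (bad p) (iota 0 (p ^ e)))%:R <= B ->
  Q%:R + B + 2 * delta * Q%:R ^+ (2 * e + 2) <=
    (v - u) / 4 * \sum_(p <- F) (p ^ e)%N%:R ->
  exists G : seq (nat * nat), [/\ uniq G,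
    forall c, c \in G -> [/\ c.1 \in F, (c.2 < c.1 ^ e)%N, ~~ bad c.1 c.2 &
      u + (v - u) / 4 <= fraction e c <= v - (v - u) / 4],
    forall c c', c \in G -> c' \in G -> c != c' ->
      delta <= `|fraction e c - fraction e c'| &
    (v - u) / 4 * \sum_(p <- F) (p ^ e)%N%:R <= (size G)%:R].
Proof.
move=> e0 uF FQ u0 uv v1 d0 dQ HB loss; set T := \sum_(p <- F) _ in loss *.
set A1 := u + _; set A2 := v - _.
pose win : pred (nat * nat) := fun c => A1 <= fraction e c <= A2.
pose clo : pred (nat * nat) := [pred c | (0 < c.2)%N & has_close e F delta c].
pose bd : pred (nat * nat) := fun c => bad c.1 c.2.
pose good : pred (nat * nat) := fun c => [&& win c, ~~ bd c & ~~ clo c].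
exists [seq c <- fractions e F | good c]; split.
- by rewrite filter_uniq // fractions_uniq.
- by move=> c; rewrite mem_filter mem_fractions => /andP[/and3P[? ? _] /andP[]].
- move=> c c'; rewrite !mem_filter => /andP[/and3P[wc _ nc] cF].
  move=> /andP[_ c'F] cc'; rewrite leNgt; apply/negP => lt.
  move: nc; rewrite /clo /= negb_and => /orP[].
    (* Numerator 0 gives the value 0, which lies left of the window since [u >= 0]. *)
    move=> c20; move: wc => /andP[+ _].
    have -> : fraction e c = 0.
      by move: c20; rewrite /fraction -leqNgt leqn0 => /eqP ->; rewrite mul0r.
    by rewrite leNgt /A1; lra.
  by move=> /hasPn /(_ _ c'F) /=; rewrite eq_sym cc' lt.
have Hcount : (count win (fractions e F) <= count good (fractions e F) +
    (count bd (fractions e F) + count clo (fractions e F)))%N.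
  elim: (fractions e F) => //= c t IH.
  move: IH; rewrite /good; clear.
  case: (win c); case: (bd c); case: (clo c) => //=; lia.
have Hclo := close_fractions_count e0 uF FQ (ltW d0) dQ.
have Hbd : (count bd (fractions e F))%:R <= B by rewrite count_fractions.
have Hwin : (v - u) / 2 * T - Q%:R <= (count win (fractions e F))%:R.
  rewrite count_fractions natr_sum.
  have sF : (size F)%:R <= Q%:R :> R.
    rewrite ler_nat -(size_iota 1 Q); apply: uniq_leq_size => // p /FQ[pp pQ].
    by rewrite mem_iota prime_gt0 //= add1n ltnS.
  apply: (@le_trans _ _ (\sum_(p <- F) ((p ^ e)%N%:R * ((v - u) / 2) - 1))).
    rewrite sumrB -mulr_suml big_const_seq count_predT iter_addr addr0.
    by rewrite -/T mulrC; lra.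
  rewrite !big_seq; apply: ler_sum => p /FQ[pp _].
  have -> : (v - u) / 2 = A2 - A1 by rewrite /A1 /A2; field.
  by apply: window_count; rewrite ?expn_gt0 ?prime_gt0 // /A1 /A2; lra.
rewrite size_filter.
move: Hcount; rewrite -(ler_nat R) !natrD; move: Hclo; rewrite -/clo.
move: loss; lra.
Qed.

End points.

(** * Lower bound for the number of primes *)

(** Legendre's formula over a range independent of [m], so that the valuations of several factorials
    can be compared term by term. *)
Lemma logn_fact_trunc p n m : prime p -> (m <= n)%N ->
  logn p m`! = (\sum_(1 <= i < (trunc_log p n).+1) m %/ p ^ i)%N.
Proof.
move=> pp mn; rewrite logn_fact //; set L := trunc_log p n.
have small i : (m < i)%N || (L < i)%N -> (m %/ p ^ i = 0)%N.
  move=> /orP[mi|Li]; apply: divn_small.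
    by apply: leq_trans mi (ltnW (ltn_expl _ (prime_gt1 pp))).
  apply: leq_ltn_trans mn _.
  apply: leq_trans (trunc_log_ltn n (prime_gt1 pp)) _.
  by rewrite leq_exp2l // prime_gt1.
have ext K : (K == m) || (K == L) ->
    (\sum_(1 <= i < K.+1) m %/ p ^ i = \sum_(1 <= i < (m + L).+1) m %/ p ^ i)%N.
  move=> KmL; have KM : (K.+1 <= (m + L).+1)%N.
    by move/orP: KmL => [/eqP|/eqP] ->; lia.
  have z : (\sum_(K.+1 <= i < (m + L).+1) m %/ p ^ i = 0)%N.
    rewrite big_nat big1 // => i /andP[Ki _]; apply: small.
    by move/orP: KmL => [/eqP <-|/eqP <-]; rewrite Ki ?orbT.
  by rewrite [RHS](big_cat_nat _ KM) //= z addn0.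
by rewrite (ext m) ?eqxx // (ext L) // eqxx orbT.
Qed.

(** In Legendre's formula for the binomial coefficient every term is at most 1, and only the
    exponents [i] with [p^i <= n] occur. *)
Lemma prime_power_bin_le p n k : prime p -> (0 < n)%N -> (k <= n)%N ->
  (p ^ logn p 'C(n, k) <= n)%N.
Proof.
move=> pp n0 kn; apply: leq_trans (trunc_logP (prime_gt1 pp) n0).
rewrite leq_exp2l ?prime_gt1 //; set L := trunc_log p n.
have : (logn p n`! <= logn p k`! + logn p (n - k)`! + L)%N.
  rewrite !(@logn_fact_trunc p n) ?leq_subr // -/L.
  have EL : L = (\sum_(1 <= i < L.+1) 1)%N.
    by rewrite sum_nat_const_nat subn1 muln1.
  rewrite [X in (_ <= _ + X)%N]EL -!big_split /=; apply: leq_sum => i _.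
  by rewrite -{1}(subnKC kn) divnD ?expn_gt0 ?prime_gt0 // leq_add2l leq_b1.
rewrite -(bin_fact kn) !lognM ?muln_gt0 ?fact_gt0 ?bin_gt0 //; lia.
Qed.

Lemma central_bin_ge n : (2 ^ n <= 'C(2 * n, n))%N.
Proof.
elim: n => // n IH.
have := mul_bin_diag (2 * n.+1) n.
have -> : (2 * n.+1 * 'C((2 * n.+1).-1, n) = n.+1 * (2 * 'C((2 * n).+1, n)))%N.
  by rewrite [in LHS]mulnS /= !mulnA; congr (_ * _)%N; lia.
move=> /eqP; rewrite eqn_pmul2l // => /eqP <-.
by rewrite expnS leq_mul2l /= (leq_trans IH) // leq_bin2l.
Qed.

Definition prime_pi (n : nat) : nat := count prime (iota 1 n).

(** Factor the binomial coefficient into prime powers: only primes up to [n] occur, and each prime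
    power is at most [n]. *)
Lemma bin_le_exp_prime_pi n k : (0 < n)%N -> (k <= n)%N ->
  ('C(n, k) <= n ^ prime_pi n)%N.
Proof.
move=> n0 kn; have C0 : (0 < 'C(n, k))%N by rewrite bin_gt0.
rewrite -{1}(partnT C0) (@widen_partn ('C(n, k) + n)) ?leq_addr //.
set M := (_ + n)%N.
apply: (@leq_trans (\prod_(0 <= p < M.+1 | prime p && (p <= n)) n)%N).
  rewrite [leqRHS]big_mkcond; apply: leq_prod => p _.
  have [pp|npp] /= := boolP (prime p); last by rewrite lognE (negPf npp).
  have := prime_power_bin_le pp n0 kn; have [//|np H] := leqP p n.
  case: (logn p _) H => [|v] // H.
  have : (p <= n)%N.
    by apply: leq_trans H; rewrite expnS leq_pmulr // expn_gt0 prime_gt0.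
  by rewrite leqNgt np.
have [->|n1] : n = 1%N \/ (1 < n)%N by lia.
  by rewrite exp1n big1.
rewrite big_const_seq iter_muln_1 leq_exp2l // /prime_pi -!size_filter.
apply: uniq_leq_size => [|p]; first by rewrite filter_uniq // iota_uniq.
rewrite !mem_filter !mem_iota => /andP[/andP[pp pn] _].
by rewrite pp prime_gt0 //= add1n ltnS.
Qed.

Section prime_asymptotics.
Context {R : realType}.
Implicit Types (kappa eps a b c : R).

Lemma near_powR_le c a b : a < b ->
  \forall Q \near \oo, c * Q%:R `^ a <= Q%:R `^ b.
Proof.
move=> ab; have ba0 : 0 < b - a by rewrite subr_gt0.
near=> Q.
have Q0 : 0 < Q%:R :> R by rewrite ltr0n; near: Q; exact: nbhs_infty_ge.
have -> : b = a + (b - a) by ring.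
rewrite powRD ?(gt_eqF Q0) ?implybT // mulrC ler_wpM2l ?powR_ge0 //.
have [c0|c0] := leP c 0; first by rewrite (le_trans c0) ?powR_ge0.
have -> : c = (c `^ (b - a)^-1) `^ (b - a).
  by rewrite -powRrM mulVf ?gt_eqF // powRr1 // ltW.
apply: ge0_ler_powR; rewrite ?nnegrE ?powR_ge0 ?(ltW ba0) ?(ltW Q0) //.
near: Q; exact: nbhs_infty_ger.
Unshelve. all: by end_near. Qed.

(** A weak Chebyshev bound: with [m] the half of [Q], the central binomial coefficient gives
    [2^m <= Q^(prime_pi Q)]. Taking logarithms loses only [ln Q], which a small power of [Q]
    absorbs. *)
Lemma near_prime_pi_ge kappa : 0 < kappa ->
  \forall Q \near \oo, Q%:R `^ (1 - kappa) <= (prime_pi Q)%:R.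
Proof.
move=> k0; set h := kappa / 2.
have h0 : 0 < h by rewrite divr_gt0.
have hk : 1 - kappa < 1 - h by rewrite /h; lra.
have l2 : 0 < ln 2 :> R by rewrite ln_gt0 // ltr1n.
have c0 : 0 < h * ln 2 / 4 by rewrite divr_gt0 ?mulr_gt0.
apply: filterS2 (nbhs_infty_ge 2) (near_powR_le (h * ln 2 / 4)^-1 hk) =>
  Q Q2 HQ.
have Q0 : 0 < Q%:R :> R by rewrite ltr0n; lia.
set m := Q./2; have m0 : (0 < m)%N by rewrite half_gt0.
have mQ : (2 * m <= Q)%N by rewrite /m mul2n -{2}(odd_double_half Q) leq_addl.
have Qm : Q%:R <= 4 * m%:R :> R.
  by rewrite -natrM ler_nat /m; have := odd_double_half Q; case: (odd Q); lia.
have H : (2 ^ m <= Q ^ prime_pi Q)%N.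
  apply: leq_trans (central_bin_ge m) _.
  apply: leq_trans (@bin_le_exp_prime_pi (2 * m) m _ _) _;
    rewrite ?leq_pmull ?muln_gt0 //.
  apply: leq_trans (_ : _ <= Q ^ prime_pi (2 * m))%N _.
    have [->|pi0] := posnP (prime_pi (2 * m)); first by rewrite !expn0.
    by rewrite leq_exp2r.
  rewrite leq_exp2l // /prime_pi.
  by rewrite -(subnKC mQ) iotaD count_cat leq_addr.
have lnH : m%:R * ln 2 <= (prime_pi Q)%:R * ln Q%:R :> R.
  move: H; rewrite -(ler_nat R) !natrX.
  rewrite -[in X in X -> _]ler_ln ?posrE ?exprn_gt0 //.
  by rewrite !lnXn // !mulr_natl.
have lnQ : ln Q%:R <= Q%:R `^ h / h.
  rewrite ler_pdivlMr // mulrC -ln_powR.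
  (* This form allows the inequality [ln (1 + x) <= x]. *)
  have -> : Q%:R `^ h = 1 + (Q%:R `^ h - 1) by ring.
  apply: le_trans (le_ln1Dx _) _; last lra.
  by have := powR_gt0 h Q0; lra.
have P1 : h * ln 2 / 4 * Q%:R `^ (1 - h) <= (prime_pi Q)%:R.
  rewrite powRD ?(gt_eqF Q0) ?implybT // powRr1 ?(ltW Q0) // powRN mulrA.
  rewrite ler_pdivrMr ?powR_gt0 //.
  have : m%:R * ln 2 <= (prime_pi Q)%:R * (Q%:R `^ h / h).
    by apply: le_trans lnH _; rewrite ler_wpM2l.
  rewrite mulrA ler_pdivlMr // => H2; apply: le_trans H2.
  have := ler_wpM2l (ltW (mulr_gt0 h0 l2)) Qm; lra.
by apply: le_trans P1; rewrite -ler_pdivrMl.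
Qed.

(** The lower cut-off keeps every [p^e] within a factor [Q^(e * kappa)] of [Q^e]. *)
Definition large_primes kappa (Q : nat) : seq nat :=
  [seq p <- iota 1 Q | prime p && (Q%:R `^ (1 - kappa) < p%:R :> R)].

Lemma near_large_primes_ge kappa : 0 < kappa ->
  \forall Q \near \oo, Q%:R `^ (1 - kappa) <= (size (large_primes kappa Q))%:R.
Proof.
move=> k0; have hk : 1 - kappa < 1 - kappa / 2 by lra.
have h0 : 0 < kappa / 2 by rewrite divr_gt0.
apply: filterS2 (near_powR_le 2 hk) (near_prime_pi_ge h0) => Q H1 H2.
have {H1 H2}H := le_trans H1 H2.
set y := Q%:R `^ (1 - kappa) in H *.
have y0 : 0 <= y by exact: powR_ge0.
have : (prime_pi Q <= size (large_primes kappa Q) + Num.truncn y)%N.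
  rewrite /prime_pi -(size_iota 1 (Num.truncn y)) -size_cat -size_filter.
  apply: uniq_leq_size; first by rewrite filter_uniq // iota_uniq.
  move=> p; rewrite mem_cat !mem_filter => /andP[pp pQ]; rewrite pp pQ andbT /=.
  have [//|py] := ltP y p%:R.
  by rewrite mem_iota prime_gt0 //= add1n ltnS truncn_ge_nat.
rewrite -(ler_nat R) natrD; have /andP[+ _] := truncn_itv y0; lra.
Qed.

(** At least [Q^(1 - kappa)] primes contribute at least [Q^((1 - kappa) * e)] each; the choice of
    [kappa] makes the total exponent [e + 1 - eps]. *)
Lemma near_sum_large_primes e eps : 0 < eps ->
  \forall Q \near \oo, Q%:R `^ (e%:R + 1 - eps) <=
    \sum_(p <- large_primes (eps / (e%:R + 1)) Q) (p ^ e)%N%:R.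
Proof.
move=> e0; have e1 : 0 < e%:R + 1 :> R by rewrite ltr_wpDl.
set kappa := eps / (e%:R + 1).
have k0 : 0 < kappa by rewrite divr_gt0.
apply: filterS2 (nbhs_infty_ge 1) (near_large_primes_ge k0) => Q Q1 HQ.
have Q0 : 0 < Q%:R :> R by rewrite ltr0n.
have -> : e%:R + 1 - eps = (1 - kappa) * e%:R + (1 - kappa).
  by rewrite /kappa; field; rewrite gt_eqF.
rewrite powRD ?(gt_eqF Q0) ?implybT // powRrM powR_mulrn ?powR_ge0 //.
set y := Q%:R `^ (1 - kappa).
apply: (@le_trans _ _ (\sum_(p <- large_primes kappa Q) y ^+ e)).
  rewrite big_const_seq count_predT iter_addr addr0 -[leRHS]mulr_natr.
  by rewrite ler_wpM2l ?exprn_ge0 ?powR_ge0.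
rewrite !big_seq; apply: ler_sum => p.
rewrite mem_filter => /andP[/andP[_ yp] _].
by rewrite natrX lerXn2r ?nnegrE ?powR_ge0 // ltW.
Qed.

End prime_asymptotics.

(** * Regular distribution of the fractions *)

Section fractions_regularity.
Context {R : realType}.
Implicit Types (u v x y eps s : R) (F : seq nat).

Lemma powRD_gt0 (q a b : R) : 0 < q -> q `^ (a + b) = q `^ a * q `^ b.
Proof. by move=> q0; rewrite powRD // (gt_eqF q0) implybT. Qed.

(** For each [p] the fractions over [p^e] are [p^(-e)] apart, so at most [1 + (y - x) * p^e] of them
    fit. *)
Lemma interval_fractions_size e F x y (G : seq (nat * nat)) :
  (forall p, p \in F -> (0 < p)%N) -> uniq G -> x <= y ->
  (forall c, c \in G -> c.1 \in F /\ x <= fraction e c <= y) ->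
  (size G)%:R <= (size F)%:R + (y - x) * \sum_(p <- F) (p ^ e)%N%:R.
Proof.
move=> F0 uG xy HG.
apply: (@le_trans _ _ (\sum_(p <- F) (size [seq c <- G | c.1 == p])%:R)).
  rewrite -natr_sum ler_nat.
  have : {subset G <= flatten [seq [seq c <- G | c.1 == p] | p <- F]}.
    move=> c cG; apply/flatten_mapP; exists c.1; first by have [] := HG _ cG.
    by rewrite mem_filter eqxx.
  move=> /(uniq_leq_size uG).
  by rewrite size_flatten /shape -map_comp sumnE big_map.
have -> : (size F)%:R + (y - x) * \sum_(p <- F) (p ^ e)%N%:R =
    \sum_(p <- F) (1 + (y - x) * (p ^ e)%N%:R).
  by rewrite big_split /= -mulr_sumr big_const_seq count_predT iter_addr addr0.
rewrite !big_seq; apply: ler_sum => p pF; have p0 := F0 _ pF.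
have q0 : 0 < (p ^ e)%N%:R :> R by rewrite ltr0n expn_gt0 p0.
set s := [seq c <- G | _].
have sP c : c \in s -> [/\ c = (p, c.2) & x <= fraction e c <= y].
  rewrite mem_filter => /andP[/eqP c1 /HG[_]]; split => //.
  by rewrite -c1; case: (c).
have sep c c' : c \in s -> c' \in s -> c != c' ->
    ((p ^ e)%N%:R)^-1 <= `|fraction e c - fraction e c'| :> R.
  move=> /sP[-> _] /sP[-> _] cc'; apply: fraction_separated => //.
  by apply: contra_neq cc' => ->.
have finj : {in s &, injective (@fraction R e)}.
  move=> c c' cs cs' E; apply/eqP/negPn/negP => cc'.
  have := sep _ _ cs cs' cc'; rewrite E subrr normr0 leNgt invr_gt0.
  by rewrite q0.
have [s0|s0] := posnP (size s).
  by rewrite s0 addr_ge0 // mulr_ge0 ?subr_ge0 // ltW.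
have [||||x' [y' [xs ys xy' _]]] :=
  @separated_size R ((p ^ e)%N%:R)^-1 (map (@fraction R e) s).
- by rewrite invr_gt0.
- by rewrite map_inj_in_uniq // filter_uniq.
- move=> _ _ /mapP[c cs ->] /mapP[c' cs' ->] cc'; apply: sep => //.
  by apply: contra_neq cc' => ->.
- by rewrite size_map.
rewrite size_map invrK lerBlDl => H; apply: le_trans H _.
move: xs ys => /mapP[c /sP[_ /andP[c1 c2]] E1].
move=> /mapP[c' /sP[_ /andP[c1' c2']] E2].
by rewrite lerD2l ler_wpM2r ?(ltW q0) // lerB // ?E1 ?E2.
Qed.

(* The exponents e + 1 - 2 eps and e + 1 - eps below leave a factor Q^eps to
   absorb every loss. *)
Lemma regular_family_fractions e s eps (W : nat -> set R) :
  (0 < e)%N -> 0 < s -> 0 < eps -> 4 * eps <= e%:R * (1 - s) -> 2 * eps <= 1 ->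
  (forall n, \forall Q \near \oo, exists rho (bad : nat -> nat -> bool),
    [/\ 0 < rho, rho <= Q%:R `^ (- (e%:R + 1 + 3 * eps)),
      Q%:R `^ (- (e%:R + 1 - 2 * eps)) <= rho `^ s,
      (\sum_(p <- large_primes (eps / (e%:R + 1)) Q)
         count (bad p) (iota 0 (p ^ e)))%:R <= Q%:R `^ (e%:R + 1 - 2 * eps) &
      forall p a y, p \in large_primes (eps / (e%:R + 1)) Q -> (a < p ^ e)%N ->
        ~~ bad p a -> `|y - fraction e (p, a)| <= rho -> W n y]) ->
  regular_family s 5 0 1 W.
Proof.
move=> e0 s0 eps0 eps4 eps2 HW u v n u0 uv v1.
have e0R : 0 < e%:R :> R by rewrite ltr0n.
have e1R : 1 <= e%:R :> R by rewrite ler1n.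
have s1 : s < 1.
  have H : 0 < e%:R * (1 - s) by apply: lt_le_trans eps4; rewrite mulr_gt0.
  by rewrite pmulr_rgt0 // subr_gt0 in H.
set l := v - u; have l0 : 0 < l by rewrite subr_gt0.
have l1 : l <= 1 by rewrite /l; lra.
have lt1 : e%:R + 1 - 2 * eps < e%:R + 1 - eps by lra.
(* The first condition on [Q] puts [rho] below [l / 4] and [1 / (2 * n.+1)]; [4 <= Q^eps] gives
   [4 * rho <= delta]; and [16 / l * X <= Y <= T] keeps all losses below [l / 4 * T]. *)
have := filter_ex (filterI (filterI (nbhs_infty_ger (4 / l + 2 * n.+1%:R))
  (near_powR_le (16 / l) lt1)) (filterI (filterI (near_powR_le 4 eps0)
  (near_sum_large_primes e eps0)) (HW n))).
set kappa := eps / (e%:R + 1).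
move=> [Q [[Q1 QX] [[Q4 QT] [rho [bad [rho0 rho1 rho2 Hbad HWQ]]]]]].
set F := large_primes kappa Q in QT Hbad HWQ.
set T := \sum_(p <- F) _ in QT.
set X := Q%:R `^ (e%:R + 1 - 2 * eps) in QX Hbad.
set Y := Q%:R `^ (e%:R + 1 - eps) in QX QT.
have l4 : 4 <= 4 / l by rewrite ler_pdivlMr // ler_piMr.
have n1 : 1 <= n.+1%:R :> R by rewrite ler1n.
have q1 : 1 <= Q%:R :> R by apply: le_trans Q1; lra.
have q0 : 0 < Q%:R :> R by lra.
have X0 : 0 < X by exact: powR_gt0.
have uF : uniq F by rewrite filter_uniq // iota_uniq.
have FQ p : p \in F -> prime p /\ (p <= Q)%N.
  by rewrite mem_filter mem_iota => /andP[/andP[pp _] /andP[_ pQ]].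
have F0 p : p \in F -> (0 < p)%N by move=> /FQ[/prime_gt0].
have sF : (size F)%:R <= Q%:R :> R.
  by rewrite ler_nat -[leqRHS](size_iota 1 Q) size_filter count_size.
(* The exponent makes [delta * Q^(2 * e + 2)], half of the bound for the close fractions, equal to
   [X]. *)
pose delta := Q%:R `^ (- (e%:R + 1 + 2 * eps)) : R.
have d0 : 0 < delta by exact: powR_gt0.
have dQ : delta * Q%:R ^+ e <= 1.
  rewrite -powR_mulrn ?(ltW q0) // -powRD_gt0 //.
  by rewrite -[leRHS](powRr0 Q%:R); apply: ler_powR => //; lra.
have dX : delta * Q%:R ^+ (2 * e + 2) = X.
  rewrite -powR_mulrn ?(ltW q0) // -powRD_gt0 // natrD natrM.
  by congr (_ `^ _); ring.
have QleX : Q%:R <= X.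
  by rewrite -[leLHS]powRr1 ?(ltW q0) //; apply: ler_powR => //; lra.
have XT : 4 * X <= l / 4 * T.
  have : l / 4 * (16 / l * X) <= l / 4 * T.
    by rewrite ler_pM2l ?divr_gt0 // (le_trans QX).
  by have -> : l / 4 * (16 / l * X) = 4 * X by field; rewrite gt_eqF.
have loss : Q%:R + X + 2 * delta * Q%:R ^+ (2 * e + 2) <= (v - u) / 4 * T.
  by rewrite -mulrA dX -/l; lra.
have [G [uG GP Gsep Gsize]] := point_set e0 uF FQ u0 uv v1 d0 dQ Hbad loss.
rewrite -/l -/T in Gsize.
have finj : {in G &, injective (@fraction R e)}.
  move=> c c' cs cs' E; apply/eqP/negPn/negP => cc'.
  by have := Gsep _ _ cs cs' cc'; rewrite E subrr normr0 leNgt d0.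
have rho4 : 4 * rho <= delta.
  have -> : delta = Q%:R `^ (- (e%:R + 1 + 3 * eps)) * Q%:R `^ eps.
    by rewrite -powRD_gt0 //; congr (_ `^ _); ring.
  rewrite powRr0 mulr1 in Q4.
  by rewrite mulrC; apply: ler_pM => //; exact: ltW.
have rhoQ : rho <= Q%:R^-1.
  apply: le_trans rho1 _; rewrite -powR_inv1 ?(ltW q0) //.
  by apply: ler_powR => //; lra.
have rhol : rho <= l / 4.
  apply: le_trans rhoQ _.
  rewrite -[l / 4]invrK lef_pV2 ?posrE ?invr_gt0 ?divr_gt0 //.
  by rewrite invf_div; lra.
have rhon : 2 * rho <= n.+1%:R^-1.
  have nQ : 2 * n.+1%:R <= Q%:R :> R.
    by apply: le_trans Q1; rewrite lerDr divr_ge0 // ltW.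
  rewrite -ler_pdivlMl //; apply: le_trans rhoQ _.
  by rewrite -invfM lef_pV2 ?posrE ?mulr_gt0.
set P := map (@fraction R e) G.
have sP : size P = size G by rewrite size_map.
have XP : 4 * X <= (size P)%:R by rewrite sP (le_trans XT).
exists rho, P; split => //; last first.
  move=> _ y /mapP[c /GP[cF ce cb _] ->] yc.
  by apply: (HWQ c.1 c.2) => //; move: yc; case: (c).
split.
- by rewrite map_inj_in_uniq.
- move=> _ /mapP[c /GP[_ _ _ /andP[c1 c2]] ->].
  by move: c1 c2 rhol; clear; rewrite -/l; move: (fraction e c); split; lra.
- move=> _ _ /mapP[c cG ->] /mapP[c' cG' ->] cc'; apply: le_trans rho4 _.
  by apply: Gsep => //; apply: contra_neq cc' => ->.
- move=> S uS SP S2.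
  have Ssep x y : x \in S -> y \in S -> x != y -> delta <= `|x - y|.
    move=> /SP /mapP[c cG ->] /SP /mapP[c' cG' ->] cc'.
    by apply: Gsep => //; apply: contra_neq cc' => ->.
  have [x [y [xS yS xy Sxy Sd]]] := separated_size d0 uS Ssep (ltnW S2).
  have xny : x != y.
    apply/negP => /eqP E; move: S2; rewrite ltnNge => /negP; apply.
    rewrite -[1%N]/(size [:: x]); apply: uniq_leq_size => // z /Sxy.
    by rewrite -E inE eq_le andbC.
  exists x, y; split => //.
  have rd : delta <= y - x.
    by have := Ssep _ _ xS yS xny; rewrite distrC ger0_norm ?subr_ge0.
  rewrite distrC ger0_norm ?subr_ge0 // -/l.
  set r := y - x in rd Sd *; have r0 : 0 < r by exact: lt_le_trans rd.
  have rl : r <= l.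
    have /mapP[c /GP[_ _ _ /andP[c1 _]] E1] := SP _ xS.
    have /mapP[c' /GP[_ _ _ /andP[_ c2]] E2] := SP _ yS.
    by move: c1 c2; rewrite -E1 -E2 /r /l; move: l0; rewrite /l; lra.
  have rs0 : 0 < r `^ s by exact: powR_gt0.
  have rls : r `^ s <= (r / l) `^ s.
    apply: ge0_ler_powR;
      rewrite ?nnegrE ?divr_ge0 ?(ltW s0) ?(ltW r0) ?(ltW l0) //.
    by rewrite ler_pdivlMr // ler_piMr // ltW.
  have mr : 4 * (r `^ s * X) <= (size P)%:R * (r / l) `^ s.
    have -> : 4 * (r `^ s * X) = 4 * X * r `^ s by ring.
    by apply: ler_pM => //; [rewrite mulr_ge0 ?ltW|exact: ltW].
  have key : Q%:R `^ (- (e%:R * (1 - s)) + e%:R + 1 + 2 * eps) <= X.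
    by apply: ler_powR => //; lra.
  (* Two ranges of the span [r]. Up to [Q^(-e)] separation suffices: [S] has at most [1 + r / delta]
     points, and [key] bounds this through [4 * eps <= e * (1 - s)]. Beyond it, points are counted
     denominator by denominator. *)
  have [rQ|Qr] := leP r (Q%:R `^ (- e%:R)).
    have rdX : r / delta <= r `^ s * X.
      have -> : r / delta = r `^ s * (r `^ (1 - s) / delta).
        rewrite mulrA -powRD_gt0 //; congr (_ / _).
        by rewrite addrC subrK powRr1 // ltW.
      rewrite ler_pM2l //; apply: le_trans key; rewrite /delta powRN invrK.
      have -> : - (e%:R * (1 - s)) + e%:R + 1 + 2 * eps =
          (- e%:R) * (1 - s) + (e%:R + 1 + 2 * eps) by ring.
      rewrite [leRHS]powRD_gt0 // ler_wpM2r ?powR_ge0 // powRrM.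
      apply: ge0_ler_powR => //; rewrite ?nnegrE ?powR_ge0 ?(ltW r0) //.
      by rewrite subr_ge0 ltW.
    have d1 : 1 <= r / delta by rewrite ler_pdivlMr // mul1r.
    rewrite -mulrA; lra.
  have Hsize : (size S)%:R <= (size F)%:R + r * T.
    pose S' := [seq c <- G | fraction e c \in S].
    apply: (@le_trans _ _ (size S')%:R).
      rewrite ler_nat -(size_map (@fraction R e)).
      apply: uniq_leq_size => // z zS.
      have /mapP[c cG E] := SP _ zS; apply/mapP; exists c => //.
      by rewrite mem_filter -E zS.
    apply: interval_fractions_size => //; first by rewrite filter_uniq.
    move=> c; rewrite mem_filter => /andP[cS /GP[cF _ _ _]].
    by split => //; exact: Sxy.
  have QX2 : Q%:R <= r `^ s * X.
    apply: (@le_trans _ _ ((Q%:R `^ (- e%:R)) `^ s * X)).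
      rewrite -powRrM -powRD_gt0 // -[leLHS]powRr1 ?(ltW q0) //.
      by apply: ler_powR => //; lra.
    rewrite ler_pM2r //.
    by apply: ge0_ler_powR; rewrite ?nnegrE ?powR_ge0 //; exact: ltW.
  (* As [r / l <= 1] and [s < 1], its [s]-th power is no smaller. By [QX2] and [mr] the term
     [size F] adds at most a quarter of [size P * (r / l)^s], whence the constant 5. *)
  have rT : r * T <= 4 * ((size P)%:R * (r / l) `^ s).
    have -> : r * T = 4 * (l / 4 * T * (r / l)) by field; rewrite gt_eqF.
    rewrite ler_pM2l //; apply: ler_pM.
    + by rewrite (le_trans _ XT) // mulr_ge0 // ltW.
    + by rewrite divr_ge0 // ltW.
    + by rewrite sP.
    + apply: ger1_powR; last exact: ltW.
      by rewrite divr_gt0 //= ler_pdivrMr // mul1r.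
  rewrite -mulrA; lra.
(* The content condition: [l^s <= 1 <= X * rho^s], and [X <= size P]. *)
- apply: (@le_trans _ _ 1).
    have <- : l `^ 0 = 1 by rewrite powRr0.
    by apply: ger_powR; rewrite ?l0 //= ltW.
  apply: (@le_trans _ _ (X * rho `^ s)).
    apply: (@le_trans _ _ (X * Q%:R `^ (- (e%:R + 1 - 2 * eps)))).
      by rewrite powRN mulfV ?gt_eqF.
    by rewrite ler_pM2l.
  apply: ler_pM; rewrite ?powR_ge0 ?(ltW X0) //; first lra.
  apply: ge0_ler_powR; rewrite ?nnegrE ?mulr_ge0 ?(ltW s0) ?(ltW rho0) //; lra.
Qed.

End fractions_regularity.

(** * Neighbourhoods of rationals with large sums *)

Section large_sums.
Context {R : realType}.
Implicit Types (alpha s tau eps : R) (d e n N : nat).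
Local Notation nm := (@Normc.normc R).

(** Infinitely many [N] are encoded as one [N] beyond each [n], so that the [n]-th stage of the
    descent secures a single one. *)
Definition large_beyond alpha d n : set R :=
  [set x | exists2 N, (n < N)%N & N%:R `^ alpha <= nm (weyl_sum d x N)].

Lemma large_beyond_large_weyl_sums alpha d (x : R) : 0 <= x < 1 ->
  (forall n, large_beyond alpha d n x) -> large_weyl_sums alpha d x.
Proof.
move=> x01 H; split => // /finite_seqP[t tE].
have [N nN HN] := H (\max_(i <- t) i)%N.
have : N \in t.
  change ([set` t] N); rewrite -tE; split; first exact: leq_ltn_trans nN.
  by rewrite normc_def lecR; case: (weyl_sum d x N) HN.
move=> Nt; have := @leq_bigmax_seq _ t predT (fun i => i) N Nt isT.
by rewrite leqNgt nN.
Qed.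

(* The bound 2 N^alpha at x costs a factor 2 when moved to y, and the sum that is
   large at y has length t >= N^alpha > n since it is at most t. *)
Lemma large_beyond_near alpha d n (x y : R) M N : 0 < alpha -> (M <= N)%N ->
  n%:R < N%:R `^ alpha ->
  2 * N%:R `^ alpha <= nm (weyl_sum d x M) ->
  `|y - x| <= (4 * pi * N%:R ^+ d)^-1 -> large_beyond alpha d n y.
Proof.
move=> a0 MN nN HM yx.
have N0 : 0 < N%:R :> R.
  rewrite ltr0n lt0n; apply/negP => /eqP N0; move: nN.
  by rewrite N0 powR0 ?gt_eqF // ltNge ler0n.
have p0 : 0 < 4 * pi :> R by rewrite mulr_gt0 ?pi_gt0.
have yx' : `|y - x| * N%:R ^+ d <= (4 * pi)^-1.
  apply: (@le_trans _ _ ((4 * pi * N%:R ^+ d)^-1 * N%:R ^+ d)).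
    by rewrite ler_wpM2r ?exprn_ge0.
  by rewrite invfM mulfVK // gt_eqF // exprn_gt0.
have [t tN Ht] := weyl_sum_stable MN yx' HM.
exists t.
  rewrite -(ltr_nat R); apply: lt_le_trans nN _.
  exact: le_trans Ht (normc_weyl_sum_le _ _ _).
apply: le_trans Ht; apply: ge0_ler_powR; rewrite ?nnegrE ?(ltW a0) ?ler_nat //.
Qed.

Definition cutoff tau (Q : nat) : nat := (Num.truncn (Q%:R `^ tau : R)).+1.

Lemma cutoff_bounds tau Q : 0 <= tau -> (0 < Q)%N ->
  Q%:R `^ tau <= (cutoff tau Q)%:R :> R /\
  (cutoff tau Q)%:R <= 2 * Q%:R `^ tau :> R.
Proof.
move=> t0 Q0; have q1 : 1 <= Q%:R :> R by rewrite ler1n.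
have y1 : 1 <= Q%:R `^ tau by rewrite -[leLHS](powRr0 Q%:R); exact: ler_powR.
have /andP[H1 H2] := truncn_itv (powR_ge0 Q%:R tau).
by split; rewrite /cutoff; [exact: ltW|rewrite -natr1; lra].
Qed.

(** With [N = cutoff tau Q], stability allows the radius [rho = 1 / (4 * pi * N^d)], of order
    [Q^(- d * tau)]. The lower bound on [d * tau] makes [rho] small against the spacing of the
    fractions; the upper bound on [d * tau * s] provides the required [s]-content. *)
Lemma regular_family_weyl d e alpha s tau eps :
  (0 < d)%N -> (0 < e)%N -> 0 < alpha -> 0 < s -> 0 < tau -> 0 < eps ->
  4 * eps <= e%:R * (1 - s) -> 2 * eps <= 1 ->
  e%:R + 1 + 3 * eps <= d%:R * tau -> d%:R * tau * s < e%:R + 1 - 2 * eps ->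
  (\forall Q \near \oo, exists bad : nat -> nat -> bool,
    (\sum_(p <- large_primes (eps / (e%:R + 1)) Q)
         count (bad p) (iota 0 (p ^ e)))%:R <= Q%:R `^ (e%:R + 1 - 2 * eps) /\
    forall p a, p \in large_primes (eps / (e%:R + 1)) Q -> (a < p ^ e)%N ->
      ~~ bad p a -> exists2 M, (M <= cutoff tau Q)%N &
        2 * (cutoff tau Q)%:R `^ alpha <=
          nm (weyl_sum d (fraction e (p, a)) M)) ->
  regular_family s 5 0 1 (large_beyond alpha d).
Proof.
move=> d0 e0 a0 s0 t0 eps0 eps4 eps2 dtau dtaus Hbad.
apply: (regular_family_fractions e0 s0 eps0 eps4 eps2) => n.
have at0 : 0 < tau * alpha by rewrite mulr_gt0.
have p0 : 0 < pi :> R by exact: pi_gt0.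
apply: filterS3 Hbad (filterI (nbhs_infty_ge 1) (near_powR_le (n.+1)%:R at0))
  (near_powR_le ((4 * pi * 2 ^+ d) `^ s) dtaus) => Q [bad [B1 B2]] [Q1 HQ1] HQ2.
have q0 : 0 < Q%:R :> R by rewrite ltr0n.
have q1 : 1 <= Q%:R :> R by rewrite ler1n.
have [N1 N2] := cutoff_bounds (ltW t0) Q1.
set N := cutoff tau Q in B2 N1 N2.
have N0 : 0 < N%:R :> R by rewrite ltr0n.
have qt0 : 0 < Q%:R `^ tau by exact: powR_gt0.
have D0 : 0 < 4 * pi * N%:R ^+ d :> R by rewrite !mulr_gt0 // exprn_gt0.
have qtd : (Q%:R `^ tau) ^+ d = Q%:R `^ (d%:R * tau).
  by rewrite -powR_mulrn ?powR_ge0 // -powRrM mulrC.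
exists (4 * pi * N%:R ^+ d)^-1, bad; split => //.
- by rewrite invr_gt0.
- rewrite powRN lef_pV2 ?posrE ?powR_gt0 //.
  apply: (@le_trans _ _ (Q%:R `^ (d%:R * tau))); first exact: ler_powR.
  rewrite -qtd; apply: (@le_trans _ _ (N%:R ^+ d)).
    by rewrite lerXn2r ?nnegrE ?powR_ge0.
  rewrite ler_peMl ?exprn_ge0 //; have := @pi_ge2 R; lra.
- have E0 : (4 * pi * N%:R ^+ d)^-1 `^ s = ((4 * pi * N%:R ^+ d) `^ s)^-1.
    by rewrite -powR_inv1 ?(ltW D0) // -powRrM mulN1r powRN.
  rewrite E0 powRN lef_pV2 ?posrE ?powR_gt0 //.
  apply: le_trans HQ2.
  rewrite powRrM -powRM ?powR_ge0 ?mulr_ge0 ?exprn_ge0 ?(ltW p0) //.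
  apply: ge0_ler_powR;
    rewrite ?nnegrE ?mulr_ge0 ?powR_ge0 ?exprn_ge0 ?(ltW p0) ?(ltW s0) //.
  rewrite -[leRHS]mulrA ler_pM2l ?mulr_gt0 // -qtd -exprMn.
  by apply: lerXn2r; rewrite ?nnegrE ?mulr_ge0 ?powR_ge0.
- move=> p a y pF pe nb yx.
  have [M MN HM] := B2 _ _ pF pe nb.
  apply: (large_beyond_near a0 MN _ HM yx).
  apply: (@lt_le_trans _ _ n.+1%:R); first by rewrite ltr_nat.
  rewrite powRr0 mulr1 in HQ1; apply: le_trans HQ1 _; rewrite powRrM.
  by apply: ge0_ler_powR; rewrite ?nnegrE ?powR_ge0 ?(ltW a0).
Qed.

Lemma near_large_primes_gt eps e D : 0 < eps -> eps <= 1 -> (0 < e)%N ->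
  \forall Q \near \oo, forall p, p \in large_primes (eps / (e%:R + 1) : R) Q ->
    [/\ prime p, (p <= Q)%N & (D < p)%N].
Proof.
move=> eps0 eps1 e0; set kappa := eps / _.
have k1 : 0 < 1 - kappa.
  rewrite /kappa subr_gt0 ltr_pdivrMr ?ltr_wpDl // mul1r.
  by apply: le_lt_trans eps1 _; rewrite ltrDr ltr0n.
apply: filterS (near_powR_le D%:R k1) => Q; rewrite powRr0 mulr1 => HQ p.
rewrite mem_filter mem_iota => /andP[/andP[pp yp] /andP[_ pQ]]; split => //.
by rewrite -(ltr_nat R); exact: le_lt_trans HQ yp.
Qed.

Lemma size_large_primes_le kappa Q : (size (@large_primes R kappa Q) <= Q)%N.
Proof. by rewrite -[leqRHS](size_iota 1 Q) size_filter count_size. Qed.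

(** Here [e = 1]. The Gauss sum, of size about [N / sqrt Q] or more, beats [N^alpha] once
    [tau * (1 - alpha) > 1 / 2], and the content condition asks for [tau * s < 1]; [tau] is the
    midpoint of the range in between. Since [alpha > 1 / 2], it exceeds 1, so the sums contain full
    periods. *)
Lemma quadratic_regular_family alpha s : 1 / 2 < alpha -> alpha < 1 -> 0 < s ->
  s < 2 * (1 - alpha) -> regular_family s 5 0 1 (large_beyond alpha 2).
Proof.
move=> a2 a1 s0 sa.
have b0 : 0 < 1 - alpha by lra.
have a0 : 0 < alpha by lra.
have s1 : s < 1 by lra.
have lt : (2 * (1 - alpha))^-1 < s^-1 by rewrite ltf_pV2 ?posrE // mulr_gt0.
pose tau := ((2 * (1 - alpha))^-1 + s^-1) / 2.
have tau1 : (2 * (1 - alpha))^-1 < tau by rewrite /tau; lra.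
have tau2 : tau < s^-1 by rewrite /tau; lra.
have tau3 : 1 < tau.
  apply: lt_trans tau1; rewrite -[1]invr1 ltf_pV2 ?posrE ?mulr_gt0 //; lra.
have ts : tau * s < 1 by rewrite -ltr_pdivlMr // mul1r.
have tb : 1 / 2 < tau * (1 - alpha).
  rewrite -ltr_pdivrMr //; apply: le_lt_trans tau1.
  by rewrite invfM div1r.
pose eps := Num.min (Num.min ((2 * tau - 2) / 3) ((1 - tau * s) / 2))
  (Num.min ((1 - s) / 4) (1 / 2)).
have [e1 e2 e3 e4] : [/\ eps <= (2 * tau - 2) / 3, eps <= (1 - tau * s) / 2,
    eps <= (1 - s) / 4 & eps <= 1 / 2].
  by split; rewrite /eps !ge_min lexx ?orbT.
have eps0 : 0 < eps.
  by rewrite /eps !lt_min; apply/andP; split; apply/andP; split; lra.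
apply: (@regular_family_weyl 2 1 alpha s tau eps) => //; try lra.
have Qle Q : (1 <= Q)%N -> Q%:R <= Q%:R `^ (1%:R + 1 - 2 * eps) :> R.
  move=> Q1; rewrite -[leLHS]powRr1 //; apply: ler_powR; first by rewrite ler1n.
  lra.
have eps1 : eps <= 1 by lra.
apply: filterS3 (nbhs_infty_ge 1) (near_powR_le 4 tb)
  (near_large_primes_gt 2 eps0 eps1 (ltn0Sn 0)) => Q Q1 HQ HF.
set kappa := eps / _ in HF *.
(* Below [p] the only bad numerator is 0, which costs one fraction per prime. *)
exists (fun p a => (p %| a)%N); split.
  apply: le_trans (Qle Q Q1); rewrite ler_nat.
  apply: leq_trans (size_large_primes_le kappa Q).
  rewrite -sum1_size !big_seq; apply: leq_sum => p /HF[pp _ _].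
  rewrite expn1 -size_filter -[1%N]/(size [:: 0%N]); apply: uniq_leq_size.
    by rewrite filter_uniq // iota_uniq.
  move=> a; rewrite mem_filter mem_iota inE => /andP[pa /andP[_ ap]].
  rewrite -leqn0 leqNgt; apply/negP => a0'.
  by move: (dvdn_leq a0' pa); rewrite leqNgt ap.
move=> p a /HF[pp pQ p2] _ pa.
have op : odd p by case: (even_prime pp) p2 => // ->.
have [N1 _] := cutoff_bounds (ltW (lt_trans ltr01 tau3)) Q1.
set N := cutoff tau Q in N1 *.
have p0 : (0 < p)%N by exact: prime_gt0.
have q1 : 1 <= Q%:R :> R by rewrite ler1n.
have q0 : 0 < Q%:R :> R by rewrite ltr0n.
have N0 : 0 < N%:R :> R by rewrite ltr0n.
have QN : (Q <= N)%N.
  rewrite -(ler_nat R); apply: le_trans N1.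
  by rewrite -[leLHS]powRr1 //; apply: ler_powR => //; exact: ltW.
exists (p * (N %/ p))%N; first by rewrite mulnC leq_divM.
rewrite /fraction /= expn1 weyl_sum_gauss //.
(* One factor 2 is the demand [2 * N^alpha], the other pays for rounding [N / p] down. *)
have main : 4 * Num.sqrt Q%:R * N%:R `^ alpha <= N%:R :> R.
  have E : N%:R = N%:R `^ (1 - alpha) * N%:R `^ alpha :> R.
    by rewrite -powRD_gt0 // subrK powRr1.
  rewrite [leRHS]E.
  rewrite ler_pM2r ?powR_gt0 // -powR12_sqrt ?ler0n // -div1r.
  apply: le_trans HQ _; rewrite powRrM.
  by apply: ge0_ler_powR; rewrite ?nnegrE ?powR_ge0 ?(ltW b0).
have sp0 : 0 < Num.sqrt p%:R :> R by rewrite sqrtr_gt0 ltr0n.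
have spQ : Num.sqrt p%:R <= Num.sqrt Q%:R :> R by rewrite ler_sqrt ?ler_nat.
have Np : N%:R <= 2 * (N %/ p)%:R * (Num.sqrt p%:R * Num.sqrt p%:R) :> R.
  rewrite -expr2 sqr_sqrtr // -!natrM ler_nat.
  by rewrite leq_double_divn // (leq_trans pQ).
rewrite -(ler_pM2r sp0) -(@ler_pM2l _ 2) //.
apply: (@le_trans _ _ (4 * Num.sqrt Q%:R * N%:R `^ alpha)).
  have := ler_wpM2r (powR_ge0 N%:R alpha) spQ; lra.
apply: le_trans main _; apply: le_trans Np _; lra.
Qed.

(** Chebyshev's inequality for the mean square. With [k = N %/ p], the bound [N <= 2 * k * p] turns
    the threshold into [N^2 <= 16 * p^2 * (k / 2)^2], the source of the 16. *)
Lemma count_coprime_weyl_sum_gt p d N :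
  prime p -> ~~ (p %| d)%N -> (p <= N)%N ->
  (count (fun a => (N %/ p)%:R / 2 <
        nm (coprime_weyl_sum p d (a%:R / (p ^ d)%N%:R : R) N))
      (iota 0 (p ^ d)))%:R * N%:R <=
    16 * d%:R * p%:R ^+ 2 * (N%:R + p%:R ^+ d) :> R.
Proof.
move=> pp pd pN; set q := (p ^ d)%N; set bad := fun a : nat => _.
have p0 : (0 < p)%N by exact: prime_gt0.
have p0R : 0 < p%:R :> R by rewrite ltr0n.
have N0 : 0 < N%:R :> R by rewrite ltr0n (leq_trans p0).
have q0 : (0 < q)%N by rewrite expn_gt0 p0.
set f := fun a : nat => nm (coprime_weyl_sum p d (a%:R / q%:R : R) N).
have k0 : 0 <= (N %/ p)%:R / 2 :> R by rewrite divr_ge0.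
have markov : (count bad (iota 0 q))%:R * ((N %/ p)%:R / 2) ^+ 2 <=
    \sum_(0 <= a < q) f a ^+ 2.
  rewrite /index_iota subn0 -sum1_count natr_sum mulr_suml big_mkcond /=.
  apply: ler_sum => a _; rewrite /bad -/(f a); case: ifP => [H|_].
    by rewrite mul1r lerXn2r ?nnegrE ?normc_ge0 // ltW.
  exact: sqr_ge0.
have := le_trans markov (mean_square_coprime_weyl_sum N pp pd).
set c := (count _ _)%:R; set k := (N %/ p)%:R in k0 markov *.
have Nk : N%:R <= 2 * k * p%:R.
  by rewrite -!natrM ler_nat leq_double_divn.
have qN : (q * (N * (d * (N %/ q).+1)))%N%:R <=
    d%:R * N%:R * (N%:R + q%:R) :> R.
  have -> : (q * (N * (d * (N %/ q).+1)) = d * N * (N %/ q * q + q))%N.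
    by rewrite -addn1; ring.
  by rewrite -natrD -!natrM ler_nat leq_mul2l leq_add2r leq_divM orbT.
move=> H.
have {}H : c * (k / 2) ^+ 2 * (16 * p%:R ^+ 2) <=
    d%:R * N%:R * (N%:R + q%:R) * (16 * p%:R ^+ 2).
  by rewrite ler_wpM2r ?mulr_ge0 ?exprn_ge0 // (le_trans H).
have H2 : c * N%:R ^+ 2 <= c * (k / 2) ^+ 2 * (16 * p%:R ^+ 2).
  have -> : c * (k / 2) ^+ 2 * (16 * p%:R ^+ 2) = c * (2 * k * p%:R) ^+ 2.
    by field.
  by rewrite ler_wpM2l ?ler0n // lerXn2r ?nnegrE ?mulr_ge0 ?ler0n.
have -> : p%:R ^+ d = q%:R :> R by rewrite natrX.
rewrite -(ler_pM2r N0); move: H; move: (q%:R : R) => Q H.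
have -> : c * N%:R * N%:R = c * N%:R ^+ 2 by ring.
apply: le_trans H2 _; apply: le_trans H _.
by rewrite le_eqVlt; apply/orP; left; apply/eqP; ring.
Qed.

(** Here [e = d]. The multiples of [p] contribute about [N / p >= N / Q], which beats [N^alpha] once
    [tau * (1 - alpha) > 1]; the content condition asks for [d * tau * s < d + 1], and [tau] is the
    midpoint of the range in between. *)
Lemma power_regular_family d alpha s : (2 < d)%N ->
  1 - alpha < 2 / (d%:R + 2) -> alpha < 1 -> 0 < s ->
  s < (1 + 1 / d%:R) * (1 - alpha) ->
  regular_family s 5 0 1 (large_beyond alpha d).
Proof.
move=> d2 a2 a1 s0 sa.
have b0 : 0 < 1 - alpha by lra.
have d3 : 3 <= d%:R :> R by rewrite ler_nat.
have d0 : 0 < d%:R :> R by lra.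
have d02 : 0 < d%:R + 2 :> R by lra.
have b52 : (1 - alpha) * 5 < 2.
  have : (1 - alpha) * (d%:R + 2) < 2 by rewrite -ltr_pdivlMr.
  have : (1 - alpha) * 5 <= (1 - alpha) * (d%:R + 2).
    by rewrite ler_pM2l //; lra.
  lra.
have sd : s * d%:R < (d%:R + 1) * (1 - alpha).
  have -> : (d%:R + 1) * (1 - alpha) = (1 + 1 / d%:R) * (1 - alpha) * d%:R.
    by field; rewrite gt_eqF.
  by rewrite ltr_pM2r.
(* Hence [d * (1 - s) > 1], which leaves room for [4 * eps]. *)
have sd1 : s * d%:R < d%:R - 1.
  apply: lt_trans sd _.
  have : (1 - alpha) * 5 * (d%:R + 1) < 2 * (d%:R + 1).
    by rewrite ltr_pM2r //; lra.
  lra.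
have lt : (1 - alpha)^-1 < (d%:R + 1) / (s * d%:R).
  by rewrite -[ltLHS]mul1r ltr_pdivrMr // mulrAC ltr_pdivlMr ?mulr_gt0 // mul1r.
pose tau := ((1 - alpha)^-1 + (d%:R + 1) / (s * d%:R)) / 2.
have tau1 : (1 - alpha)^-1 < tau by rewrite /tau; lra.
have tau2 : tau < (d%:R + 1) / (s * d%:R) by rewrite /tau; lra.
(* Sums longer than [Q^(5/2)] make the exceptional numerators rare: the bound [Q^(d + 2) / N] is
   smaller than [Q^d] by more than [Q^(3 * eps)]. *)
have tau3 : 5 / 2 < tau.
  apply: lt_trans tau1; rewrite -[ltRHS]mul1r ltr_pdivlMr //; lra.
have ts : d%:R * tau * s < d%:R + 1.
  by move: tau2; rewrite ltr_pdivlMr ?mulr_gt0 // (mulrC s) mulrA (mulrC tau).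
have tb : 1 < tau * (1 - alpha) by rewrite -ltr_pdivrMr // div1r.
have dt : 5 / 2 * d%:R <= d%:R * tau by rewrite mulrC ler_pM2l // ltW.
pose eps := Num.min ((d%:R + 1 - d%:R * tau * s) / 3) (1 / 12).
have [e1 e2] : eps <= (d%:R + 1 - d%:R * tau * s) / 3 /\ eps <= 1 / 12.
  by split; rewrite /eps !ge_min lexx ?orbT.
have eps0 : 0 < eps by rewrite /eps !lt_min; apply/andP; split; lra.
have eps1 : eps <= 1 by lra.
have tau0 : 0 < tau by lra.
have d0n : (0 < d)%N by exact: ltnW (ltnW d2).
have a0 : 0 < alpha by lra.
apply: (@regular_family_weyl d d alpha s tau eps) => //; try lra.
have lt3 : d%:R + 1 - 3 * eps < d%:R + 1 - 2 * eps by lra.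
apply: filterS3 (nbhs_infty_ge 1) (filterI (near_powR_le 8 tb)
  (near_powR_le (32 * d%:R) lt3))
  (near_large_primes_gt d eps0 eps1 d0n) => Q Q1 [HQ HQ2] HF.
set kappa := eps / _ in HF *.
have [N1 _] := cutoff_bounds (ltW tau0) Q1.
set N := cutoff tau Q in N1 *.
have q1 : 1 <= Q%:R :> R by rewrite ler1n.
have q0 : 0 < Q%:R :> R by rewrite ltr0n.
have N0 : 0 < N%:R :> R by rewrite ltr0n.
have main : 8 * Q%:R * N%:R `^ alpha <= N%:R :> R.
  have E : N%:R = N%:R `^ (1 - alpha) * N%:R `^ alpha :> R.
    by rewrite -powRD_gt0 // subrK powRr1.
  rewrite [leRHS]E ler_pM2r ?powR_gt0 //.
  rewrite powRr1 ?(ltW q0) // in HQ; apply: le_trans HQ _; rewrite powRrM.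
  by apply: ge0_ler_powR; rewrite ?nnegrE ?powR_ge0 ?(ltW b0).
have QN : (Q <= N)%N.
  rewrite -(ler_nat R); apply: le_trans N1.
  by rewrite -[leLHS]powRr1 ?(ltW q0) //; apply: ler_powR => //; lra.
have Np p : (0 < p)%N -> (p <= Q)%N -> N%:R <= 2 * (N %/ p)%:R * p%:R :> R.
  by move=> p0 pQ; rewrite -!natrM ler_nat leq_double_divn // (leq_trans pQ).
pose bad p a := (N %/ p)%:R / 2 <
  nm (coprime_weyl_sum p d (a%:R / (p ^ d)%N%:R) N).
exists bad; split; last first.
  move=> p a /HF[pp pQ dp] _ nb; exists N => //.
  have p0 : (0 < p)%N by exact: prime_gt0.
  have p0R : 0 < p%:R :> R by rewrite ltr0n.
  rewrite /fraction /= weyl_sum_prime_powerE //.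
  move: nb; rewrite /bad -leNgt; set z := coprime_weyl_sum _ _ _ _ => zN.
  (* Outside the bad set the coprime part is at most half of the contribution [N %/ p] of the
     multiples of [p]. *)
  have := normc_subl (N %/ p)%:R (- z); rewrite opprK normcN normc_nat.
  have : 2 * N%:R `^ alpha <= (N %/ p)%:R / 2; last lra.
  rewrite -(ler_pM2r p0R).
  have H1 := Np p p0 pQ.
  have H2 : p%:R * N%:R `^ alpha <= Q%:R * N%:R `^ alpha.
    by rewrite ler_wpM2r ?powR_ge0 // ler_nat.
  lra.
apply: le_trans HQ2.
(* Each of the two terms [N] and [p^d] in [count_coprime_weyl_sum_gt] is absorbed separately, which
   doubles 16 to 32. *)
have Hp p : p \in large_primes kappa Q ->
    (count (bad p) (iota 0 (p ^ d)))%:R <= 32 * d%:R * Q%:R `^ (d%:R - 3 * eps).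
  move=> /HF[pp pQ dp]; have p0 : (0 < p)%N by exact: prime_gt0.
  have pd : ~~ (p %| d)%N by rewrite gtnNdvd.
  have pQ2 : p%:R ^+ 2 <= Q%:R ^+ 2 :> R by rewrite lerXn2r ?nnegrE ?ler_nat.
  have pQd : p%:R ^+ d <= Q%:R ^+ d :> R by rewrite lerXn2r ?nnegrE ?ler_nat.
  rewrite -(ler_pM2r N0).
  apply: le_trans (count_coprime_weyl_sum_gt pp pd (leq_trans pQ QN)) _.
  have H1 : p%:R ^+ 2 * N%:R <= Q%:R `^ (d%:R - 3 * eps) * N%:R.
    rewrite ler_wpM2r //; apply: le_trans pQ2 _.
    rewrite -powR_mulrn //; apply: ler_powR => //; lra.
  have H2 : p%:R ^+ 2 * p%:R ^+ d <= Q%:R `^ (d%:R - 3 * eps) * N%:R.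
    apply: (@le_trans _ _ (Q%:R ^+ 2 * Q%:R ^+ d)).
      by rewrite ler_pM ?exprn_ge0.
    apply: (@le_trans _ _ (Q%:R `^ (d%:R - 3 * eps) * Q%:R `^ tau)); last first.
      by rewrite ler_wpM2l ?powR_ge0.
    rewrite -exprD -powR_mulrn // -powRD_gt0 // natrD.
    by apply: ler_powR => //; lra.
  have -> : 16 * d%:R * p%:R ^+ 2 * (N%:R + p%:R ^+ d) =
      16 * d%:R * (p%:R ^+ 2 * N%:R + p%:R ^+ 2 * p%:R ^+ d) :> R by ring.
  have -> : 32 * d%:R * Q%:R `^ (d%:R - 3 * eps) * N%:R = 16 * d%:R *
      (Q%:R `^ (d%:R - 3 * eps) * N%:R + Q%:R `^ (d%:R - 3 * eps) * N%:R).
    by ring.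
  by rewrite ler_wpM2l ?mulr_ge0 // lerD.
rewrite natr_sum.
apply: (@le_trans _ _ (\sum_(p <- large_primes kappa Q)
    32 * d%:R * Q%:R `^ (d%:R - 3 * eps))).
  by rewrite !big_seq; apply: ler_sum => p; exact: Hp.
rewrite big_const_seq count_predT iter_addr addr0 -[leLHS]mulr_natr.
have -> : d%:R + 1 - 3 * eps = d%:R - 3 * eps + 1 by ring.
rewrite [Q%:R `^ (_ + 1)]powRD_gt0 // powRr1 ?(ltW q0) // mulrA.
rewrite ler_wpM2l ?mulr_ge0 ?powR_ge0 //.
by rewrite ler_nat size_large_primes_le.
Qed.

End large_sums.

(** * Arbitrary intervals of the torus and the dimension bounds *)

Section large_sums_in_interval.
Context {R : realType}.
Implicit Types (alpha s t : R) (d : nat) (I : set R).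

(** Cutting [J] at the first integer after [a] leaves a piece on which [frac_part] is a translation;
    stopping at its midpoint keeps the right end below 1. *)
Lemma torus_interval_segment I : torus_interval I ->
  exists u v : R, [/\ 0 <= u, u < v, v < 1 & forall x, u <= x <= v -> I x].
Proof.
move=> [J [Jint [a [b [Ja Jb ab]]] ->]].
set m : R := (Num.floor a)%:~R.
have /andP[ma am] : m <= a < m + 1 by have := floor_itv a; rewrite intrD.
pose c := Num.min b (m + 1).
have [cb cm] : c <= b /\ c <= m + 1 by rewrite /c !ge_min !lexx orbT.
have ac : a < c by rewrite /c lt_min ab am.
exists (a - m), ((a + c) / 2 - m); split; [lra|lra|lra|].
move=> x /andP[x1 x2]; exists (x + m).
  by apply: (Jint a b) => //; apply/andP; split; lra.
rewrite /frac_part (@floor_def _ _ (Num.floor a)) ?addrK //.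
by rewrite intrD -/m; apply/andP; split; lra.
Qed.

(** Raising the exponent to [alpha'] only shrinks the set, as [N^alpha <= N^alpha'] for [N >= 1].
    This reaches the small [alpha], where the bound no longer depends on [alpha]. *)
Lemma hausdorff_measure_large_weyl_sums alpha alpha' s t d I :
  0 <= t -> t < s -> s <= 1 -> alpha <= alpha' ->
  regular_family s 5 0 1 (large_beyond alpha' d) -> torus_interval I ->
  hausdorff_measure t (large_weyl_sums alpha d `&` I) <> 0%E.
Proof.
move=> t0 ts s1 aa' fam /torus_interval_segment[u [v [u0 uv v1 uvI]]].
apply: (@regular_family_hausdorff_measure R s t 5 u v (large_beyond alpha' d))
  => //.
  move=> u' v' n uu' uv' vv'; apply: fam => //; first exact: le_trans uu'.
  exact: le_trans vv' (ltW v1).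
move=> x xuv H; split; last exact: uvI.
have /andP[ux xv] := xuv.
apply: large_beyond_large_weyl_sums.
  by rewrite (le_trans u0 ux) (le_lt_trans xv v1).
move=> n; have [N nN HN] := H n; exists N => //; apply: le_trans HN.
by apply: ler_powR => //; rewrite ler1n (leq_ltn_trans _ nN).
Qed.

End large_sums_in_interval.

Theorem theorem1p7 (R : realType) (alpha : R) (I : set R)
    (alpha_gt0 : 0 < alpha) (alpha_lt1 : alpha < 1) (hI : torus_interval I) :
  ((Num.min 1 (2 * (1 - alpha)))%:E
    <= hausdorff_dim (large_weyl_sums alpha 2 `&` I))%E /\
  (forall d : nat, (3 <= d)%N ->
    (((1 + 1 / d%:R) * Num.min (2 / (d%:R + 2)) (1 - alpha))%:E
      <= hausdorff_dim (large_weyl_sums alpha d `&` I))%E).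
Proof.
split; [|move=> d d3]; apply: hausdorff_dim_ge => t t0.
  rewrite lt_min => /andP[t1 ta].
  (* For [alpha <= 1 / 2] this [alpha'] makes [2 * (1 - alpha')] the midpoint of [t] and 1. *)
  have [alpha' [aa' a2 a1 ta']] : exists alpha', [/\ alpha <= alpha',
      1 / 2 < alpha', alpha' < 1 & t < 2 * (1 - alpha')].
    have [a2|a2] := ltP (1 / 2) alpha; first by exists alpha.
    by exists (1 - (t + 1) / 4); split; lra.
  pose s := (t + 2 * (1 - alpha')) / 2.
  have [s0 ts sa] : [/\ 0 < s, t < s & s < 2 * (1 - alpha')].
    by rewrite /s; split; lra.
  apply: (@hausdorff_measure_large_weyl_sums R alpha alpha' s) => //; first lra.
  exact: quadratic_regular_family.
have d0 : 3 <= d%:R :> R by rewrite ler_nat.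
set c := 1 + 1 / d%:R; set b := 2 / (d%:R + 2) => ta.
have c1 : 1 < c by rewrite /c ltrDl divr_gt0 //; lra.
have b0 : 0 < b by rewrite /b divr_gt0 //; lra.
have b25 : b <= 2 / 5.
  by rewrite /b ler_pM2l // lef_pV2 ?posrE; lra.
have c43 : c <= 4 / 3.
  rewrite /c; have : d%:R^-1 <= 3^-1 :> R by rewrite lef_pV2 ?posrE; lra.
  lra.
(* This keeps the auxiliary exponent [s] at most 1. *)
have cb1 : c * b <= 1.
  have : c * b <= 4 / 3 * (2 / 5) by apply: ler_pM => //; lra.
  lra.
have [tb ta2] : t / c < b /\ t / c < 1 - alpha.
  move: ta; rewrite mulrC -ltr_pdivrMr; last lra.
  by rewrite lt_min => /andP[].
have tc0 : 0 <= t / c by rewrite divr_ge0 //; lra.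
(* When [b <= 1 - alpha], [alpha'] is chosen so that [1 - alpha'] is the midpoint of [t / c] and
   [b]. *)
have [alpha' [aa' a1 ab ta']] : exists alpha', [/\ alpha <= alpha',
    alpha' < 1, 1 - alpha' < b & t / c < 1 - alpha'].
  have [ab|ab] := ltP (1 - alpha) b; first by exists alpha.
  by exists (1 - (t / c + b) / 2); split; lra.
have tca : t < c * (1 - alpha').
  by rewrite mulrC -ltr_pdivrMr //; lra.
pose s := (t + c * (1 - alpha')) / 2.
have [s0 ts sa] : [/\ 0 < s, t < s & s < c * (1 - alpha')].
  by rewrite /s; split; lra.
apply: (@hausdorff_measure_large_weyl_sums R alpha alpha' s) => //.
  apply: le_trans (ltW sa) _; apply: le_trans cb1.
  by rewrite ler_pM2l; lra.
exact: power_regular_family.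
Qed.
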